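(* Let $(X,\mu)$ be a $\sigma$-finite measure space and let $f,g\in L^1(X,\mu)$ be nonnegative. Then the following are equivalent: (1) $g\prec f$; (2) there exists a sequence $(S_k)_{k\ge1}$ of semi-doubly stochastic operators on $L^1(X)$ such that $S_kf\to g$ in $L^1(X)$; (3) there exists a sequence $(I_n)_{n\ge1}$ of semi-doubly stochastic integral operators on $L^1(X)$ such that $I_nf\to g$ in $L^1(X)$; (4) $\int_X\phi(g)\,d\mu\le\int_X\phi(f)\,d\mu$ for every increasing convex function $\phi:\mathbb{R}^+\to\mathbb{R}^+$ with $\phi(0)=0$, and $\int_X g\,d\mu=\int_X f\,d\mu$; (5) $\int_X(g-u)^+\,d\mu\le\int_X(f-u)^+\,d\mu$ for every positive real number $u$, and $\int_X g\,d\mu=\int_X f\,d\mu$.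
   Context: For a measurable function $h$, $d_h(t)=\mu\{x:h(x)>t\}$ and $h^\downarrow(s)=\inf\{t:d_h(t)\le s\}$ for $0\le s\le\mu(X)$. For nonnegative $g,f\in L^1(X)$, $g\prec f$ means $\int_0^s g^\downarrow\,dm\le\int_0^s f^\downarrow\,dm$ for all $0\le s\le\mu(X)$ and $\int_0^{\mu(X)} g^\downarrow\,dm=\int_0^{\mu(X)} f^\downarrow\,dm$ ($m$ Lebesgue measure). A semi-doubly stochastic operator is a positive linear operator $T:L^1(X)\to L^1(X)$ with $\int_X Th\,d\mu=\int_X h\,d\mu$ for all $h\in L^1(X)$ and $\int_X T^*\chi_E\,d\mu\le\mu(E)$ for every measurable $E$ with $\mu(E)<\infty$, where $T^*$ is the Banach adjoint on $L^\infty(X)$. A semi-doubly stochastic integral operator is $(Ih)(x)=\int_X K(x,y)h(y)\,d\mu(y)$ where $K:X\times X\to[0,\infty)$ is measurable with $\int_X K(x,y)\,d\mu(x)=1$ for almost all $y$ and $\int_X K(x,y)\,d\mu(y)\le1$ for almost all $x$. $(h-u)^+=\max\{h-u,0\}$. *)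

(* Defs.v *)
From HB Require Import structures.
From mathcomp Require Import all_boot all_order all_algebra.
From mathcomp Require Import all_classical all_reals all_analysis.
Set Implicit Arguments. Unset Strict Implicit. Unset Printing Implicit Defensive.
Import Order.TTheory GRing.Theory Num.Theory.
Local Open Scope classical_set_scope.
Local Open Scope ring_scope.
Local Open Scope ereal_scope.

Section defs.
Context {d : measure_display} {T : measurableType d} {R : realType}.
Variable mu : {measure set T -> \bar R}.

Definition L1 (h : T -> R) : Prop := mu.-integrable setT (EFin \o h).

Definition ae_eq (h1 h2 : T -> R) : Prop := {ae mu, forall x, h1 x = h2 x}.

Definition distfun (h : T -> R) (t : R) : \bar R := mu [set x | (t < h x)%R].

Definition decrearr (h : T -> R) (s : R) : \bar R :=
  ereal_inf [set t%:E | t in [set t : R | distfun h t <= s%:E]].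

Definition majorized (g f : T -> R) : Prop :=
  (forall s : R, (0 <= s)%R -> s%:E <= mu setT ->
     \int[@lebesgue_measure R]_(r in [set r : R | (0 <= r <= s)%R]) decrearr g r
     <= \int[@lebesgue_measure R]_(r in [set r : R | (0 <= r <= s)%R]) decrearr f r) /\
  \int[@lebesgue_measure R]_(r in [set r : R | (0 <= r)%R /\ r%:E <= mu setT]) decrearr g r
  = \int[@lebesgue_measure R]_(r in [set r : R | (0 <= r)%R /\ r%:E <= mu setT]) decrearr f r.

Definition Linfty (psi : T -> R) : Prop :=
  measurable_fun setT psi /\ exists M : R, {ae mu, forall x, (`|psi x| <= M)%R}.

(* Semi-doubly stochastic operator on L^1, with L^1 elements represented
   by functions: S maps L^1 to L^1, respects a.e. equality, is linear,
   positive, integral preserving, and for every E of finite measure the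
   Banach adjoint S^* chi_E (the psi in L^infty with
   int psi h = int chi_E (S h) for all h in L^1) has integral <= mu E. *)
Definition semi_doubly_stochastic (S : (T -> R) -> (T -> R)) : Prop :=
  [/\ (forall h, L1 h -> L1 (S h)),
      (forall h1 h2, L1 h1 -> L1 h2 -> ae_eq h1 h2 -> ae_eq (S h1) (S h2)),
      (forall (a b : R) h1 h2, L1 h1 -> L1 h2 ->
         ae_eq (S (fun x => a * h1 x + b * h2 x)%R) (fun x => a * S h1 x + b * S h2 x)%R),
      (forall h, L1 h -> {ae mu, forall x, (0 <= h x)%R} ->
         {ae mu, forall x, (0 <= S h x)%R}) &
      ((forall h, L1 h -> \int[mu]_x (S h x)%:E = \int[mu]_x (h x)%:E) /\
      (forall E, measurable E -> mu E < +oo ->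
         exists psi, [/\ Linfty psi,
           (forall h, L1 h ->
              \int[mu]_x (psi x * h x)%:E = \int[mu]_x (\1_E x * S h x)%:E) &
           \int[mu]_x (psi x)%:E <= mu E]))].

Definition sds_kernel (K : T * T -> R) : Prop :=
  [/\ measurable_fun setT K, (forall xy, (0 <= K xy)%R),
      {ae mu, forall y, \int[mu]_x (K (x, y))%:E = 1} &
      {ae mu, forall x, \int[mu]_y (K (x, y))%:E <= 1}].

Definition int_op (K : T * T -> R) (h : T -> R) : T -> R :=
  fun x => fine (\int[mu]_y (K (x, y) * h y)%:E).

Definition L1_cvg (u : nat -> T -> R) (g : T -> R) : Prop :=
  (fun n => \int[mu]_x (`|u n x - g x|)%:E) @ \oo --> 0.

End defs.

(* increasing convex phi : R^+ -> R^+ with phi 0 = 0 (given on R, only its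
   restriction to [0, +oo) matters) *)
Definition admissible_phi {R : realType} (phi : R -> R) : Prop :=
  [/\ phi 0 = 0, (forall x, 0 <= x -> 0 <= phi x),
      (forall x y, 0 <= x -> x <= y -> phi x <= phi y) &
      (forall x y t, 0 <= x -> 0 <= y -> 0 <= t <= 1 ->
         phi (t * x + (1 - t) * y) <= t * phi x + (1 - t) * phi y)]%R.

(* Main.v *)
Require Import Defs.
From HB Require Import structures.
From mathcomp Require Import all_boot all_order all_algebra.
From mathcomp Require Import all_classical all_reals all_analysis.
From mathcomp Require Import measurable_realfun ring lra.
Set Implicit Arguments. Unset Strict Implicit. Unset Printing Implicit Defensive.
Import Order.TTheory GRing.Theory Num.Theory.
Import numFieldNormedType.Exports.
Local Open Scope classical_set_scope.
Local Open Scope ring_scope.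

(** Write H_h(u) for the integral of (h - u)^+.  A layer-cake computation shows
    that the integral of the rearrangement of h over [0, s] is the minimum of
    s u + H_h(u) over u >= 0, so (1) and (5) are dual to each other, and
    (5) => (4) holds because every admissible phi is the pointwise limit from
    below of positive combinations of functions (x - u)^+.  For a semi-doubly
    stochastic S, splitting f as min(f, u) + (f - u)^+ and testing S f against
    the set {S f > u} gives H_{Sf} <= H_f, which passes to L^1 limits.

    The core is (5) => (3).  Let g' <= g be a step function with values
    b_1 > b_2 > ... on sets B_i of measure w_i.  One removes successively from
    f densities p_i with total mass at most w_i and with integral of p_i f
    equal to w_i b_i, the sum of the p_i being at most 1.  Taking p_i as close
    to the level b_i as possible (the "shadow" of the mass w_i at b_i) keeps
    the rest of g' dominated by the rest of f: on the interval that p_i empties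
    the excess of the remainder is affine, whereas that of g' is convex.  The
    kernel with value p_i(y) / w_i for x in B_i then sends f to g', and it can
    be completed to a semi-doubly stochastic one; since the integral is
    preserved, the completion contributes only the integral of g - g'. *)

(** * Integrable functions and shadows *)

(** Neither [mu] nor the law of [f] need be atomless, so g' cannot in general be reached by cutting
    the space into sets. Pieces of [f] are removed as densities instead, and the lower level [a] of
    a shadow carries a free fraction [l] that absorbs a plateau of [f]. One tangency condition
    determines both [a] and the share [k] left above [b], and thereby the mean; [l] then adjusts the
    mass. The mass can fall short of w_i only for [a = 0], where points with f = 0 would add mass
    but no integral.

    Approximating [g] from below keeps the domination of the excess but loses the equality of the
    integrals, so the induction carries domination only. The columns must finally have mass exactly
    1 while the rows stay at most 1. On a space of infinite measure both defects have infinite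
    integral and a single normalised product cannot fill them, hence the two cases of the
    completion. *)

Section L1_calculus.
Context {d : measure_display} {T : measurableType d} {R : realType}.
Variable mu : {measure set T -> \bar R}.
Implicit Types (h k : T -> R) (c u : R).

Lemma L1_measurable h : L1 mu h -> measurable_fun setT h.
Proof. by move=> /measurable_int/measurable_EFinP. Qed.

Lemma L1_dominated h k : measurable_fun setT h -> (forall x, `|h x| <= k x) ->
  L1 mu k -> L1 mu h.
Proof.
move=> mh hk; apply: le_integrable => //; first exact/measurable_EFinP.
by move=> x _ /=; rewrite lee_fin (le_trans (hk x))// ler_norm.
Qed.

Lemma L1D h k : L1 mu h -> L1 mu k -> L1 mu (fun x => h x + k x).
Proof. by move=> ih ik; exact: (integrableD _ ih ik). Qed.

Lemma L1B h k : L1 mu h -> L1 mu k -> L1 mu (fun x => h x - k x).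
Proof. by move=> ih ik; exact: (integrableB _ ih ik). Qed.

Lemma L1Z c h : L1 mu h -> L1 mu (fun x => c * h x).
Proof. by move=> ih; exact: (integrableZl _ _ ih). Qed.

Lemma L1_norm h : L1 mu h -> L1 mu (fun x => `|h x|).
Proof. by move=> ih; exact: (integrable_norm ih). Qed.

Lemma L1_ge0P h : measurable_fun setT h -> (forall x, 0 <= h x) ->
  (\int[mu]_x (h x)%:E < +oo)%E -> L1 mu h.
Proof.
move=> mh h0 hoo; apply/integrableP; split; first exact/measurable_EFinP.
by under eq_integral do rewrite /= ger0_norm//.
Qed.

Lemma L1_EFin h : L1 mu h ->
  (\int[mu]_x (h x)%:E)%E = (\int[mu]_x h x)%:E.
Proof. by move=> ih; rewrite /Rintegral fineK// integrable_fin_num. Qed.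

Lemma RintD h k : L1 mu h -> L1 mu k ->
  \int[mu]_x (h x + k x) = \int[mu]_x h x + \int[mu]_x k x.
Proof. by move=> ih ik; exact: RintegralD. Qed.

Lemma RintB h k : L1 mu h -> L1 mu k ->
  \int[mu]_x (h x - k x) = \int[mu]_x h x - \int[mu]_x k x.
Proof. by move=> ih ik; exact: RintegralB. Qed.

Lemma RintZ c h : L1 mu h -> \int[mu]_x (c * h x) = c * \int[mu]_x h x.
Proof. by move=> ih; exact: RintegralZl. Qed.

Lemma le_Rint h k : L1 mu h -> L1 mu k -> (forall x, h x <= k x) ->
  \int[mu]_x h x <= \int[mu]_x k x.
Proof. by move=> ih ik hk; exact: le_Rintegral. Qed.

Lemma eq_Rint h k : h =1 k -> \int[mu]_x h x = \int[mu]_x k x.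
Proof. by move=> hk; apply: eq_Rintegral => x _. Qed.

Lemma indic_set (P : T -> bool) x : \1_[set x | P x] x = (P x)%:R :> R.
Proof.
by rewrite indicE; have [h|/negP h] := boolP (P x); [rewrite mem_set|rewrite memNset].
Qed.

Lemma measurable_pospart h u : measurable_fun setT h ->
  measurable_fun setT (fun x => Num.max (h x - u) 0).
Proof.
by move=> mh; apply: measurable_maxr => //; exact: measurable_funB.
Qed.

Lemma measurable_gtset h u : measurable_fun setT h ->
  measurable [set x | u < h x].
Proof.
move=> mh; have := mh measurableT _ (measurable_itv `]u, +oo[).
by rewrite setTI; congr measurable; apply/seteqP; split=> x/=;
   rewrite in_itv/= andbT.
Qed.

Lemma measurable_geset h u : measurable_fun setT h ->
  measurable [set x | u <= h x].
Proof.
move=> mh; have := mh measurableT _ (measurable_itv `[u, +oo[).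
by rewrite setTI; congr measurable; apply/seteqP; split=> x/=;
   rewrite in_itv/= andbT.
Qed.

Lemma measurable_indic_gt h u : measurable_fun setT h ->
  measurable_fun setT (fun x => (u < h x)%R%:R : R).
Proof.
move=> mh; rewrite (_ : (fun x => _) = \1_[set x | u < h x]).
  exact/measurable_indic/measurable_gtset.
by apply/funext => x; rewrite indic_set.
Qed.

Lemma measurable_indic_ge h u : measurable_fun setT h ->
  measurable_fun setT (fun x => (u <= h x)%R%:R : R).
Proof.
move=> mh; rewrite (_ : (fun x => _) = \1_[set x | u <= h x]).
  exact/measurable_indic/measurable_geset.
by apply/funext => x; rewrite indic_set.
Qed.

(** Fatou needs no dominating function, so this serves for masses not yet known to be finite and for
    convex integrals that may be infinite. *)
Lemma fatou_bound (h_ : nat -> T -> R) h (c : \bar R) :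
  (forall n, measurable_fun setT (h_ n)) -> (forall n x, 0 <= h_ n x) ->
  (forall x, h_ ^~ x @ \oo --> h x) ->
  (forall n, (\int[mu]_x (h_ n x)%:E <= c)%E) ->
  (\int[mu]_x (h x)%:E <= c)%E.
Proof.
move=> mh h0 hh hc.
rewrite (eq_integral (fun x => limn_einf (fun n => (h_ n x)%:E))); last first.
  move=> x _; apply/esym/(cvg_limn_einf_sup _).1.
  by apply: cvg_EFin; [exact: nearW|exact: hh].
apply: le_trans (fatou mu _ _ _) _ => //.
- by move=> n; exact/measurable_EFinP.
- by move=> n x _; rewrite lee_fin.
rewrite limn_einf_lim; apply: lime_le; first exact: is_cvg_einfs.
apply: nearW => n; apply: le_trans (hc n).
by apply: ereal_inf_lbound; exists n => /=.
Qed.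

End L1_calculus.

Lemma cvg_pospart {R : realType} {U : Type} (F : set_system U) {FF : Filter F}
    (h : U -> R) (l : R) :
  h @ F --> l -> Num.max (h x) 0 @[x --> F] --> Num.max l 0.
Proof.
move=> hl; have E x : Num.max x 0 = 2^-1 * (x + `|x|) :> R.
  by rewrite maxr_absE subr0 addr0 mulrC.
rewrite E; under eq_fun do rewrite E.
by apply: cvgM; [exact: cvg_cst|apply: cvgD => //; exact: cvg_norm].
Qed.

(** * Pointwise identities for the density of a shadow *)

Section shadow_weight.
Context {R : realType}.
Implicit Types k a b l u y : R.

(* [1 - k] above [b], [1] on [(a, b]], [l] at [a] and [0] below [a], when [a <= b]. *)
Definition shadow_weight (k a b l y : R) : R :=
  (a < y)%R%:R - k * (b < y)%R%:R + l * ((a <= y)%R%:R - (a < y)%R%:R).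

Lemma shadow_weight01 k a b l y : 0 <= k <= 1 -> a <= b -> 0 <= l <= 1 ->
  0 <= shadow_weight k a b l y <= 1.
Proof.
move=> k01 ab l01; rewrite /shadow_weight.
by case: (ltgtP a y) => h1; case: (ltP b y) => h2 /=; lra.
Qed.

(** Once integrated, the first two terms give [w * (b - a)] by tangency, and the last gives [a]
    times the mass; the mean is therefore [w * b] if the mass is [w] or [a = 0]. *)
Lemma shadow_weight_mean k a b l y : a <= b ->
  shadow_weight k a b l y * y = Num.max (y - a) 0 -
    k * (Num.max (y - b) 0 + (b - a) * (b < y)%R%:R) + a * shadow_weight k a b l y.
Proof.
rewrite /shadow_weight => ab; rewrite !maxEle !subr_le0.
case: (ltgtP a y) => ay; case: (ltP b y) => bY /=; first [exfalso; lra|ring|idtac].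
by rewrite ay; ring.
Qed.

(** Above such a level [u] the remainder only has points above [b], with weight [k]; its excess is
    therefore affine in [u]. *)
Lemma shadow_weight_mid k a b l u y : a <= u -> u < b ->
  (1 - shadow_weight k a b l y) * Num.max (y - u) 0 =
  k * (Num.max (y - b) 0 + (b - u) * (b < y)%R%:R).
Proof.
rewrite /shadow_weight => au ub; rewrite !maxEle !subr_le0.
case: (ltgtP a y) => ay; case: (ltP b y) => bY; case: (leP y u) => yu /=;
  first [exfalso; lra|ring].
Qed.

(** The weight vanishes below [a], so for these [u] the removed excess depends on the mass and the
    mean of the shadow alone. *)
Lemma shadow_weight_low k a b l u y : a <= b -> u < a ->
  shadow_weight k a b l y * Num.max (y - u) 0 = shadow_weight k a b l y * (y - u).
Proof.
rewrite /shadow_weight => ab ua; rewrite !maxEle !subr_le0.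
case: (ltgtP a y) => ay; case: (ltP b y) => bY; case: (leP y u) => yu /=;
  first [exfalso; lra|ring].
Qed.

End shadow_weight.

(** * Tangency and the construction of a shadow *)

Section shadow.
Context {d : measure_display} {T : measurableType d} {R : realType}.
Variable mu : {measure set T -> \bar R}.
Variables f rho : T -> R.
Hypothesis f1 : L1 mu f.
Hypothesis f0 : forall x, 0 <= f x.
Hypothesis mrho : measurable_fun setT rho.
Hypothesis rho01 : forall x, 0 <= rho x <= 1.

Let mf : measurable_fun setT f := L1_measurable f1.

(** The weight [rho] stands for what earlier shadows have left of [f]. *)
Definition excess (u : R) : R := \int[mu]_x (rho x * Num.max (f x - u) 0).
Definition mass_gt (u : R) : R := \int[mu]_x (rho x * (u < f x)%R%:R).
Definition mass_ge (u : R) : R := \int[mu]_x (rho x * (u <= f x)%R%:R).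

Let rho_ge0 x : 0 <= rho x. Proof. by case/andP: (rho01 x). Qed.
Let rho_le1 x : rho x <= 1. Proof. by case/andP: (rho01 x). Qed.

Lemma excess_L1 u : 0 <= u -> L1 mu (fun x => rho x * Num.max (f x - u) 0).
Proof.
move=> u0; apply: (L1_dominated _ _ f1).
  by apply: measurable_funM => //; exact: measurable_pospart.
move=> x; rewrite ger0_norm; last by rewrite mulr_ge0// le_max lexx orbT.
have := f0 x; have := rho_ge0 x; have := rho_le1 x => r1 r0 fx.
by case: (leP (f x - u)) => h; nra.
Qed.

Lemma mass_ge_L1 u : 0 < u -> L1 mu (fun x => rho x * (u <= f x)%R%:R).
Proof.
move=> u0; apply: (@L1_dominated _ _ _ _ _ (fun x => u^-1 * f x)).
- by apply: measurable_funM => //; exact: measurable_indic_ge.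
- move=> x; rewrite ger0_norm; last by rewrite mulr_ge0.
  rewrite [leRHS]mulrC ler_pdivlMr//.
  have := f0 x; have := rho_ge0 x; have := rho_le1 x => r1 r0 fx.
  by case: (leP u (f x)) => h /=; nra.
- exact: L1Z.
Qed.

Lemma mass_gt_L1 u : 0 < u -> L1 mu (fun x => rho x * (u < f x)%R%:R).
Proof.
move=> u0; apply: (L1_dominated _ _ (mass_ge_L1 u0)).
- by apply: measurable_funM => //; exact: measurable_indic_gt.
- move=> x; rewrite ger0_norm; last by rewrite mulr_ge0.
  by rewrite ler_wpM2l// ler_nat; case: ltgtP.
Qed.

Lemma excess_ge0 u : 0 <= excess u.
Proof.
by apply: Rintegral_ge0 => x _; rewrite mulr_ge0// le_max lexx orbT.
Qed.

Lemma mass_gt_ge0 u : 0 <= mass_gt u.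
Proof. by apply: Rintegral_ge0 => x _; rewrite mulr_ge0. Qed.

(** Together with [excess_diff_le] this makes [- mass_gt u] a subgradient of the convex function
    [excess] at [u], which later converts tangency into bounds on masses. *)
Lemma excess_diff_ge a u : 0 <= a -> a < u ->
  (u - a) * mass_gt u <= excess a - excess u.
Proof.
move=> a0 au; have u0 : 0 < u by exact: le_lt_trans au.
rewrite -RintB; [|exact: excess_L1|exact/excess_L1/ltW].
rewrite -RintZ; last exact: mass_gt_L1.
apply: le_Rint.
- exact/L1Z/mass_gt_L1.
- by apply: L1B; [exact: excess_L1|exact/excess_L1/ltW].
- move=> x; have := rho_ge0 x => r0.
  by case: (leP (f x - a)) => h1; case: (leP (f x - u)) => h2;
     case: (ltP u (f x)) => h3 /=; nra.
Qed.

Lemma excess_diff_le u a : 0 < u -> u < a ->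
  excess u - excess a <= (a - u) * mass_gt u.
Proof.
move=> u0 ua; have a0 : 0 < a by exact: lt_trans ua.
rewrite -RintB; [|exact/excess_L1/ltW|exact/excess_L1/ltW].
rewrite -RintZ; last exact: mass_gt_L1.
apply: le_Rint.
- by apply: L1B; exact/excess_L1/ltW.
- exact/L1Z/mass_gt_L1.
- move=> x; have := rho_ge0 x => r0.
  by case: (leP (f x - a)) => h1; case: (leP (f x - u)) => h2;
     case: (ltP u (f x)) => h3 /=; nra.
Qed.

(** At negative levels the integral may diverge on a space of infinite measure. The constant
    extension to the left of 0 gives the two-sided continuity at 0 that the extreme value theorem is
    fed with. *)
Lemma excess_continuous : continuous (fun u : R => excess (Num.max u 0)).
Proof.
move=> u; apply: (@continuity_under_integral _ _ _ mu
  (fun u x => rho x * Num.max (f x - Num.max u 0) 0) setT measurableT (u - 1)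
  (u + 1) _ _ f f1).
- by move=> v _; apply: excess_L1; rewrite le_max lexx orbT.
- apply: aeW => x _ v _.
  apply: cvgM; first exact: cvg_cst.
  apply: cvg_pospart; apply: cvgB; first exact: cvg_cst.
  by apply: cvg_pospart; exact: cvg_id.
- move=> v _; apply: aeW => x _.
  rewrite ger0_norm; last by rewrite mulr_ge0// le_max lexx orbT.
  have := f0 x; have := rho_ge0 x; have := rho_le1 x => r1 r0 fx.
  by case: (leP v) => hv; case: (leP (f x - _)) => h; nra.
- by rewrite inE/= in_itv/=; lra.
Qed.

(** The extended integral matters at [a = 0]: the mass could be infinite, and [mass_gt] would then
    read 0. In this form the bound also yields integrability. *)
Lemma mass_gt_bound a b c : 0 <= a -> a < b ->
  (forall u, a < u -> u < b -> mass_gt u <= c) ->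
  (\int[mu]_x (rho x * (a < f x)%R%:R)%:E <= c%:E)%E.
Proof.
move=> a0 ab H.
pose v n : R := a + (b - a) / 2 * n.+1%:R^-1.
have va n : a < v n < b.
  rewrite /v ltrDl mulr_gt0 ?divr_gt0 ?subr_gt0//=.
  have : (n.+1%:R : R)^-1 <= 1 by rewrite invf_le1// ler1n.
  have : 0 < (n.+1%:R : R)^-1 by rewrite invr_gt0.
  by move: (_^-1) => y *; nra.
have v0 n : 0 < v n by case/andP: (va n) => + _; exact: le_lt_trans.
have vcvg : v @ \oo --> a.
  rewrite -[X in _ --> X]addr0; apply: cvgD; first exact: cvg_cst.
  rewrite -[X in _ --> X](mulr0 ((b - a) / 2)).
  by apply: cvgM; [exact: cvg_cst|exact: cvg_harmonic].
apply: (@fatou_bound _ _ _ mu (fun n x => rho x * (v n < f x)%R%:R)).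
- by move=> n; apply: measurable_funM => //; exact: measurable_indic_gt.
- by move=> n x; rewrite mulr_ge0.
- move=> x; apply: cvgM; first exact: cvg_cst.
  apply: cvg_near_cst; have [ax|xa] := ltP a (f x).
    near=> n; rewrite (_ : v n < f x)//.
    by near: n; apply: (cvgr_lt _ vcvg).
  apply: nearW => n; congr (_%:R); congr nat_of_bool; apply/negbTE; rewrite -leNgt.
  by apply: le_trans xa _; apply/ltW; case/andP: (va n).
- move=> n; rewrite L1_EFin; last exact: mass_gt_L1.
  by rewrite lee_fin; case/andP: (va n) => ? ?; exact: H.
Unshelve. all: by end_near. Qed.

(** The sets where [f] exceeds [v n] shrink to the set where [a <= f], so Fatou points the wrong
    way; keeping [v n] above [a / 2] provides a dominating function of finite mass. *)
Lemma mass_ge_bound a c : 0 < a ->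
  (forall u, 0 < u -> u < a -> c <= mass_gt u) -> c <= mass_ge a.
Proof.
move=> a0 H.
pose v n : R := a - a / 2 * n.+1%:R^-1.
have va n : a / 2 <= v n < a.
  have : (n.+1%:R : R)^-1 <= 1 by rewrite invf_le1// ler1n.
  have : 0 < (n.+1%:R : R)^-1 by rewrite invr_gt0.
  by rewrite /v; move: (_^-1) => y *; apply/andP; split; nra.
have v0 n : 0 < v n.
  by case/andP: (va n) => + _; apply: lt_le_trans; rewrite divr_gt0.
have vcvg : v @ \oo --> a.
  rewrite -[X in _ --> X]subr0; apply: cvgB; first exact: cvg_cst.
  rewrite -[X in _ --> X](mulr0 (a / 2)).
  by apply: cvgM; [exact: cvg_cst|exact: cvg_harmonic].
have a20 : 0 < a / 2 by rewrite divr_gt0.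
rewrite -lee_fin -L1_EFin; last exact: mass_ge_L1.
have cvgM : (\int[mu]_x (rho x * (v n < f x)%R%:R)%:E)%E @[n --> \oo] -->
            (\int[mu]_x (rho x * (a <= f x)%R%:R)%:E)%E.
  apply: (@dominated_cvg _ _ _ mu setT measurableT _ _
    (fun x => (rho x * (a / 2 <= f x)%R%:R)%:E)) => //.
  - move=> n; apply/measurable_EFinP; apply: measurable_funM => //.
    exact: measurable_indic_gt.
  - move=> x _; apply: cvg_EFin; first exact: nearW.
    apply: cvgM; first exact: cvg_cst.
    apply: cvg_near_cst; have [ax|xa] := leP a (f x).
      apply: nearW => n; rewrite (_ : v n < f x)//.
      by apply: lt_le_trans ax; case/andP: (va n).
    near=> n; congr (_%:R); congr nat_of_bool; apply/negbTE; rewrite -leNgt ltW//.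
    by near: n; apply: (cvgr_gt _ vcvg).
  - exact: mass_ge_L1.
  - move=> n x _ /=; rewrite lee_fin ger0_norm; last by rewrite mulr_ge0.
    rewrite ler_wpM2l// ler_nat; case: ltP => //= vx.
    by rewrite (le_trans _ (ltW vx))//; case/andP: (va n).
rewrite -(cvg_lim _ cvgM)//; apply: lime_ge; first by apply/cvg_ex; eexists; exact: cvgM.
apply: nearW => n; rewrite L1_EFin; last exact: mass_gt_L1.
by rewrite lee_fin; case/andP: (va n) => ? ?; exact: H.
Unshelve. all: by end_near. Qed.

(* The minimum of the quotient of [excess u - w (b - u)] by the affine function
   is attained, at [a]; there the two graphs are tangent. *)
Lemma touching_line w b : 0 <= w -> 0 < b ->
  (forall u, 0 <= u -> u <= b -> w * (b - u) <= excess u) ->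
  exists k a, [/\ 0 <= k <= 1, 0 <= a <= b,
   forall u, 0 <= u -> u <= b ->
     k * (excess b + (b - u) * mass_gt b) <= excess u - w * (b - u) &
   k * (excess b + (b - a) * mass_gt b) = excess a - w * (b - a)].
Proof.
move=> w0 b0 H.
have Mb := mass_gt_ge0 b.
(* Here the denominator of the quotient would vanish at [b]. Nothing lies above [b], and the shadow
   can sit entirely at the level [b]. *)
have [Hb0|Hb0] := eqVneq (excess b) 0.
  exists 0, b; split.
  - by rewrite lexx ler01.
  - by rewrite lexx ltW.
  - by move=> u u0 ub; rewrite mul0r subr_ge0 H.
  - by rewrite mul0r Hb0 subrr mulr0 subr0.
have Hb : 0 < excess b by rewrite lt_def Hb0 excess_ge0.
pose L u := excess b + (b - u) * mass_gt b.
have L0 u : u <= b -> 0 < L u.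
  by move=> ub; rewrite ltr_pwDl// mulr_ge0// subr_ge0.
pose q u := (excess (Num.max u 0) - w * (b - u)) / L u.
have qc : {within `[0, b], continuous q}.
  apply: continuous_in_subspaceT => u; rewrite inE/= in_itv/= => /andP[u0 ub].
  apply: cvgM.
    apply: cvgB; first exact: excess_continuous.
    by apply: cvgM; [exact: cvg_cst|apply: cvgB; [exact: cvg_cst|exact: cvg_id]].
  apply: cvgV; first by rewrite gt_eqF// L0.
  apply: cvgD; first exact: cvg_cst.
  by apply: cvgM; [apply: cvgB; [exact: cvg_cst|exact: cvg_id]|exact: cvg_cst].
have qE u : 0 <= u -> u <= b -> q u * L u = excess u - w * (b - u).
  by move=> u0 ub; rewrite /q max_l// divfK// gt_eqF// L0.
have [a + amin] := EVT_min (ltW b0) qc.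
rewrite in_itv/= => /andP[a0 ab]; exists (q a), a; split.
- apply/andP; split.
    by rewrite /q divr_ge0// ?(ltW (L0 _ _))// max_l// subr_ge0 H.
  (* At [b] itself the quotient equals 1, which bounds the minimum. *)
  apply: le_trans (amin b _) _; first by rewrite in_itv/= lexx ltW.
  by rewrite /q max_l ?(ltW b0)// subrr mulr0 subr0 /L subrr mul0r addr0 divff.
- by rewrite a0.
- move=> u u0 ub; rewrite -qE// ler_wpM2r ?(ltW (L0 _ _))//.
  by apply: amin; rewrite in_itv/= u0.
- by rewrite qE.
Qed.
Let weight k a b l x := shadow_weight k a b l (f x).

Let weight_measurable k a b l : measurable_fun setT (weight k a b l).
Proof.
have ma := measurable_indic_gt a mf; have mb := measurable_indic_gt b mf.
have mc := measurable_indic_ge a mf.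
apply: measurable_funD; [apply: measurable_funB => //|];
  apply: measurable_funM => //; exact: measurable_funB.
Qed.

(** The difference of the two graphs is nonnegative and vanishes at [a], so its slope there is
    nonnegative on the right and nonpositive on the left. The slopes of [excess] being [- mass_gt a]
    and [- mass_ge a], this brackets [w + k * mass_gt b]. *)
Let mass_touching w k a b : 0 <= w -> 0 < b -> 0 <= k <= 1 -> 0 <= a <= b ->
  (forall u, 0 <= u -> u <= b ->
     k * (excess b + (b - u) * mass_gt b) <= excess u - w * (b - u)) ->
  k * (excess b + (b - a) * mass_gt b) = excess a - w * (b - a) ->
  [/\ L1 mu (fun x => rho x * (a < f x)%R%:R),
      mass_gt a <= w + k * mass_gt b &
      0 < a -> w + k * mass_gt b <= mass_ge a].
Proof.
move=> w0 b0 /andP[k0 k1] /andP[a0 ab] below touch.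
have Mb := mass_gt_ge0 b.
have bound : (\int[mu]_x (rho x * (a < f x)%R%:R)%:E <= (w + k * mass_gt b)%:E)%E.
  move: ab; rewrite le_eqVlt => /predU1P[abE|altb].
    (* For [a = b] there is no room on the right inside [[0, b]]. Either nothing lies above [b], or
       touching forces [k = 1] and the bound is immediate. *)
    have [Hb0|Hb0] := eqVneq (excess b) 0.
      apply: (@le_trans _ _ 0%:E); last by rewrite lee_fin addr_ge0// mulr_ge0.
      have a1 : a < a + 1 by rewrite ltrDl.
      apply: (mass_gt_bound a0 a1) => u au _.
      have := excess_diff_ge a0 au; rewrite abE -/(excess b) Hb0.
      have := excess_ge0 u; rewrite -/(excess u) -/(mass_gt u) => *.
      by rewrite leNgt; apply/negP => ?; nra.
    have k1E : k = 1.
      move: touch; rewrite abE subrr mul0r mulr0 addr0 subr0 -[RHS]mul1r.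
      by move/(mulIf Hb0).
    rewrite -abE L1_EFin; last by apply: mass_gt_L1; rewrite abE.
    by rewrite lee_fin k1E mul1r -/(mass_gt a) lerDr.
  apply: (mass_gt_bound a0 altb) => u au ub.
  have u0 : 0 <= u by apply: ltW; exact: le_lt_trans au.
  have := excess_diff_ge a0 au; have := below u u0 (ltW ub).
  rewrite -/(excess u) -/(excess a) -/(mass_gt u) => B E.
  rewrite -(ler_pM2l (x := u - a)) ?subr_gt0//.
  by apply: le_trans E _; lra.
have aL1 : L1 mu (fun x => rho x * (a < f x)%R%:R).
  apply: L1_ge0P.
  - by apply: measurable_funM => //; exact: measurable_indic_gt.
  - by move=> x; rewrite mulr_ge0.
  - exact: le_lt_trans bound (ltry _).
split => //; first by rewrite -lee_fin -L1_EFin.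
move=> a_gt0; apply: mass_ge_bound => // u u0 ua.
have := excess_diff_le u0 ua; have := below u (ltW u0) (ltW (lt_le_trans ua ab)).
rewrite -/(excess u) -/(excess a) -/(mass_gt u) => B E.
rewrite -(ler_pM2l (x := a - u)) ?subr_gt0//.
by apply: le_trans _ E; lra.
Qed.

Lemma shadow (w b : R) (G : R -> R) : 0 <= w -> 0 < b ->
  (forall u, 0 <= u -> u <= b -> w * (b - u) + G u <= excess u) ->
  (forall u, 0 <= G u) -> (forall u, b <= u -> G u = 0) ->
  (forall a u, a <= u -> u <= b -> (b - a) * G u <= (b - u) * G a) ->
  exists p : T -> R, [/\ measurable_fun setT p, (forall x, 0 <= p x <= rho x),
    L1 mu p, \int[mu]_x p x <= w &
    \int[mu]_x (p x * f x) = w * b /\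
    forall u, 0 <= u -> G u <= \int[mu]_x ((rho x - p x) * Num.max (f x - u) 0)].
Proof.
move=> w0 b0 dom G0 Gb Gchord.
have gtE u : \int[mu]_x (rho x * (u < f x)%R%:R) = mass_gt u by [].
have geE u : \int[mu]_x (rho x * (u <= f x)%R%:R) = mass_ge u by [].
have exE u : \int[mu]_x (rho x * Num.max (f x - u) 0) = excess u by [].
have [|k [a [k01 aab below touch]]] := touching_line w0 b0.
  by move=> u u0 ub; apply: le_trans (dom u u0 ub); rewrite lerDl.
have [aL1 mass_le mass_geq] := mass_touching w0 b0 k01 aab below touch.
case/andP: (aab) => a0 ab.
have bL1 := mass_gt_L1 b0.
pose P l x := rho x * weight k a b l x.
(* The fraction [l] of the set where [f] equals [a] brings the mass to exactly [w]. For [a = 0]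
   nothing is taken from the zero set of [f], and the mass may stay below [w]. *)
have [l [l01 PL1 JP Ja]] : exists l, [/\ 0 <= l <= 1, L1 mu (P l),
    \int[mu]_x (P l x) <= w & 0 < a -> \int[mu]_x (P l x) = w].
  move: a0; rewrite le_eqVlt => /predU1P[aE|a_gt0].
    exists 0; rewrite lexx ler01.
    have PE x : rho x * (a < f x)%R%:R - k * (rho x * (b < f x)%R%:R) = P 0 x.
      by rewrite /P /weight /shadow_weight; ring.
    split => //.
    - by rewrite (_ : P 0 = fun x => rho x * (a < f x)%R%:R -
        k * (rho x * (b < f x)%R%:R)); [exact: L1B (L1Z _ _)|
        apply/funext => x].
    - rewrite -(eq_Rint _ PE) RintB// ?RintZ//; last exact: L1Z.
      by rewrite !gtE; lra.
    - by rewrite -aE ltxx.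
  have cL1 := mass_ge_L1 a_gt0.
  pose D := mass_ge a - mass_gt a; pose n := w - (mass_gt a - k * mass_gt b).
  have n0 : 0 <= n by rewrite /n; lra.
  have nD : n <= D by have := mass_geq a_gt0; rewrite /n /D; lra.
  (* If [D = 0] then [n = 0] as well, and the convention for division by zero gives the right
     value. *)
  have lD : n / D * D = n.
    have [D0|D0] := eqVneq D 0; last by rewrite divfK.
    by rewrite D0 mulr0; apply/eqP; rewrite eq_le n0 -D0 nD.
  have JE : \int[mu]_x (P (n / D) x) = w.
    rewrite (@eq_Rint _ _ _ mu _ (fun x => (rho x * (a < f x)%R%:R -
      k * (rho x * (b < f x)%R%:R)) + n / D * (rho x * (a <= f x)%R%:R -
      rho x * (a < f x)%R%:R))); last by move=> x; rewrite /P /weight /shadow_weight; ring.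
    have e1 := L1Z k bL1; have e2 := L1B aL1 e1; have e3 := L1B cL1 aL1.
    rewrite (RintD e2 (L1Z (n / D) e3)) (RintB aL1 e1) (RintZ _ e3) (RintB cL1 aL1).
    rewrite (RintZ _ bL1).
    by rewrite !gtE !geE -/D lD /n; lra.
  have l01 : 0 <= n / D <= 1.
    apply/andP; split; first by rewrite divr_ge0// (le_trans n0).
    have [D0|D0] := eqVneq D 0; first by rewrite D0 invr0 mulr0.
    by rewrite ler_pdivrMr ?mul1r// lt_def D0 (le_trans n0).
  exists (n / D); split => //.
  - apply: (L1_dominated _ _ cL1); first exact: measurable_funM.
    move=> x; have /andP[W0 W1] := shadow_weight01 (f x) k01 ab l01.
    rewrite /P ger0_norm ?mulr_ge0// ler_wpM2l//.
    have [//|xa] := leP a (f x); rewrite /weight /shadow_weight.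
    by rewrite (leNgt a) xa (ltNge a) (ltW xa) (ltNge b) (ltW (lt_le_trans xa ab)) /=; lra.
  - by rewrite JE.
case/andP: (k01) => k0 k1.
have w01 x : 0 <= weight k a b l x <= 1 := shadow_weight01 (f x) k01 ab l01.
have P0 x : 0 <= P l x <= rho x.
  by case/andP: (w01 x) => ? ?; rewrite /P mulr_ge0//= ler_piMr.
have mP : measurable_fun setT (P l) by exact: measurable_funM.
have PfL1 : L1 mu (fun x => P l x * f x).
  apply: (L1_dominated _ _ f1); first exact: measurable_funM.
  move=> x; case/andP: (P0 x) => Px0 ?; rewrite ger0_norm; last exact: mulr_ge0 Px0 _.
  by rewrite ler_piMl// (le_trans _ (rho_le1 x)).
pose tail u x := rho x * Num.max (f x - b) 0 + (b - u) * (rho x * (b < f x)%R%:R).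
have HbL1 := excess_L1 (ltW b0).
have tailL1 u : L1 mu (tail u) by exact: L1D HbL1 (L1Z _ bL1).
have Jtail u : \int[mu]_x tail u x = excess b + (b - u) * mass_gt b.
  by rewrite RintD ?RintZ//; exact: L1Z.
have JPf : \int[mu]_x (P l x * f x) = w * b.
  rewrite (@eq_Rint _ _ _ mu _ (fun x => (rho x * Num.max (f x - a) 0 - k * tail a x)
    + a * P l x)); last first.
    by move=> x; rewrite /P /weight -mulrA shadow_weight_mean// /tail; ring.
  have HaL1 := excess_L1 a0.
  have e1 := L1Z k (tailL1 a).
  rewrite (RintD (L1B HaL1 e1) (L1Z a PL1)) (RintB HaL1 e1).
  rewrite (RintZ _ (tailL1 a)) (RintZ _ PL1).
  rewrite Jtail touch exE.
  move: a0; rewrite le_eqVlt => /predU1P[aE|/Ja ->]; last by ring.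
  by rewrite -aE; ring.
exists (P l); split => //; split => // u u0.
have HuL1 := excess_L1 u0.
have [bu|ub] := leP b u.
  rewrite Gb//; apply: Rintegral_ge0 => x _; case/andP: (P0 x) => _ ?.
  by rewrite mulr_ge0 ?subr_ge0// le_max lexx orbT.
have [au|ua] := leP a u.
  rewrite (@eq_Rint _ _ _ mu _ (fun x => k * tail u x)); last first.
    move=> x; rewrite (_ : rho x - P l x = rho x * (1 - weight k a b l x)).
      by rewrite -mulrA shadow_weight_mid// /tail; ring.
    by rewrite /P; ring.
  rewrite RintZ// Jtail.
  (* [G] lies below its chord from [a] to its zero [b]. The affine excess of the remainder is at
     least [G a] at [a] and nonnegative at [b], so it dominates that chord. *)
  have := Gchord a u au (ltW ub); have := dom a a0 ab; have := excess_ge0 b.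
  rewrite -/(excess b) -/(excess a) => E1 E2 E3.
  rewrite -(ler_pM2l (x := b - a)) ?subr_gt0; last exact: le_lt_trans ub.
  apply: le_trans E3 _.
  have E4 : (b - u) * G a <= (b - u) * (k * (excess b + (b - a) * mass_gt b)).
    by rewrite ler_wpM2l ?touch ?subr_ge0 ?(ltW ub)//; lra.
  apply: le_trans E4 _.
  have : 0 <= (u - a) * (k * excess b) by rewrite !mulr_ge0// subr_ge0.
  by move=> *; lra.
(* Below [a] the shadow has mass exactly [w] and removes [w * (b - u)] from the excess, the amount
   that the hypothesis on [G] leaves free. *)
rewrite (@eq_Rint _ _ _ mu _ (fun x => rho x * Num.max (f x - u) 0 -
    (P l x * f x - u * P l x))); last first.
  by move=> x; rewrite mulrBl /P /weight -(mulrA _ (shadow_weight _ _ _ _ _) (Num.max _ _)) shadow_weight_low//; ring.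
have e1 := L1Z u PL1.
rewrite (RintB HuL1 (L1B PfL1 e1)) (RintB PfL1 e1) RintZ//.
rewrite JPf Ja ?exE; last exact: le_lt_trans ua.
by have := dom u u0 (ltW (lt_le_trans ua ab)); lra.
Qed.
End shadow.

(** * Kernel operators are semi-doubly stochastic *)

Section kernel_operators.
Context {d : measure_display} {T : measurableType d} {R : realType}.
Variable mu : {sigma_finite_measure set T -> \bar R}.
Implicit Types (K : T * T -> R) (h : T -> R).

Lemma measurable_kernel_l K x : measurable_fun setT K ->
  measurable_fun setT (fun y => K (x, y)).
Proof. by move=> mK; exact: measurableT_comp mK (pair1_measurable _). Qed.

Lemma measurable_kernel_r K y : measurable_fun setT K ->
  measurable_fun setT (fun x => K (x, y)).
Proof. by move=> mK; exact: measurableT_comp mK (pair2_measurable _). Qed.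

Section subkernel.
Variable K : T * T -> R.
Hypothesis mK : measurable_fun setT K.
Hypothesis K0 : forall z, 0 <= K z.
Hypothesis K1 : {ae mu, forall y, (\int[mu]_x (K (x, y))%:E <= 1)%E}.

Let kh h z := (K z * h z.2)%:E.

Let mkh h : measurable_fun setT h -> measurable_fun setT (kh h).
Proof.
move=> mh; apply/measurable_EFinP; apply: measurable_funM => //.
exact: measurableT_comp mh measurable_snd.
Qed.

(** This is the adjoint operator applied to the constant 1; for a kernel cut down to the rows in [E]
    it is the adjoint applied to [\1_E]. *)
Definition col_mass y : R := fine (\int[mu]_x (K (x, y))%:E).

Lemma measurable_col_integral :
  measurable_fun setT (fun y => \int[mu]_x (K (x, y))%:E)%E.
Proof.
apply: (measurable_fun_fubini_tonelli_G (fun z => (K z)%:E)) => //.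
exact/measurable_EFinP.
Qed.

Lemma measurable_col_mass : measurable_fun setT col_mass.
Proof.
by apply: measurableT_comp measurable_col_integral; exact: fine_measurable.
Qed.

Lemma col_mass_ge0 y : 0 <= col_mass y.
Proof. by rewrite fine_ge0// integral_ge0// => x _; rewrite lee_fin. Qed.

Lemma col_massE : {ae mu, forall y, (\int[mu]_x (K (x, y))%:E = (col_mass y)%:E)%E}.
Proof.
apply: filterS K1 => y y1; rewrite fineK// ge0_fin_numE.
  exact: le_lt_trans y1 (ltry _).
by apply: integral_ge0 => x _; rewrite lee_fin.
Qed.

Lemma col_mass_le1 : {ae mu, forall y, col_mass y <= 1}.
Proof. by apply: filterS2 K1 col_massE => y + yE; rewrite yE lee_fin. Qed.

(** Tonelli with [x] integrated first: columns of mass at most 1 bound the double integral by the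
    norm of [h]. Every later exchange of integrals rests on this. *)
Lemma subkernel_integrable h : L1 mu h ->
  ((mu \x mu)%E).-integrable setT (kh h).
Proof.
move=> h1; have mh := L1_measurable h1.
apply/integrable21ltyP; first exact: mkh.
have E y : (\int[mu]_x `|kh h (x, y)| = `|h y|%:E * \int[mu]_x (K (x, y))%:E)%E.
  rewrite -ge0_integralZl//.
  - by apply: eq_integral => x _; rewrite /kh/= normrM ger0_norm// mulrC.
  - by apply/measurable_EFinP; exact: measurable_kernel_r.
  - by move=> x _; rewrite lee_fin.
under eq_integral do rewrite E.
apply: (@le_lt_trans _ _ (\int[mu]_y `|h y|%:E)%E); last first.
  by case/integrableP: h1.
apply: ae_ge0_le_integral => //.
- by move=> y _; rewrite mule_ge0// integral_ge0// => x _; rewrite lee_fin.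
- apply: emeasurable_funM; last exact: measurable_col_integral.
  by apply/measurable_EFinP; exact: measurableT_comp.
- by apply/measurable_EFinP; exact: measurableT_comp.
- by apply: filterS K1 => y y1 _; rewrite -[leRHS]mule1 lee_wpmul2l.
Qed.

Lemma int_op_ae h : L1 mu h -> {ae mu, forall x,
  mu.-integrable setT (fun y => (K (x, y) * h y)%:E)}.
Proof. by move=> h1; exact: ae_integrable1 (subkernel_integrable h1). Qed.

Lemma int_op_EFin h : L1 mu h -> {ae mu, forall x,
  (int_op mu K h x)%:E = (\int[mu]_y (K (x, y) * h y)%:E)%E}.
Proof.
move=> h1; apply: filterS (int_op_ae h1) => x ix.
by rewrite /int_op fineK// integrable_fin_num.
Qed.

Lemma measurable_int_op h : L1 mu h -> measurable_fun setT (int_op mu K h).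
Proof.
move=> h1; apply: measurableT_comp; first exact: fine_measurable.
exact: (measurable_fubini_F (subkernel_integrable h1)).
Qed.

Lemma int_op_L1 h : L1 mu h -> L1 mu (int_op mu K h).
Proof.
move=> h1; apply: le_integrable (integrable_fubini_F (subkernel_integrable h1)) => //.
  by apply/measurable_EFinP; exact: measurable_int_op.
move=> x _; rewrite /= /int_op /fubini_F /kh/=.
by case: (\int[mu]_y _)%E => [r| |] /=; rewrite ?leey.
Qed.

Lemma integral_int_op h : L1 mu h ->
  (\int[mu]_x (int_op mu K h x)%:E = \int[mu]_y (col_mass y * h y)%:E)%E.
Proof.
move=> h1; have ikh := subkernel_integrable h1; have mh := L1_measurable h1.
transitivity (\int[mu]_x fubini_F mu (kh h) x)%E.
  apply: ae_eq_integral => //.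
  - by apply/measurable_EFinP; exact: measurable_int_op.
  - exact: (measurable_fubini_F ikh).
  - by apply: filterS (int_op_EFin h1) => x xE _.
rewrite integral12_prod_meas1// -integral21_prod_meas1//.
apply: ae_eq_integral => //.
- exact: (measurable_fubini_G ikh).
- by apply/measurable_EFinP; apply: measurable_funM => //; exact: measurable_col_mass.
- apply: filterS col_massE => y yE _; rewrite /fubini_G /kh/= EFinM -yE muleC.
  under eq_integral do rewrite mulrC EFinM.
  have iK : mu.-integrable setT (fun x => (K (x, y))%:E).
    apply/integrableP; split; first by apply/measurable_EFinP; exact: measurable_kernel_r.
    by under eq_integral do rewrite /= ger0_norm//; rewrite yE ltry.
  by rewrite integralZl.
Qed.

Lemma int_op_ae_eq h1 h2 : L1 mu h1 -> L1 mu h2 -> Defs.ae_eq mu h1 h2 ->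
  Defs.ae_eq mu (int_op mu K h1) (int_op mu K h2).
Proof.
move=> i1 i2 h12; apply: aeW => x; rewrite /int_op; congr fine.
have m1 := L1_measurable i1; have m2 := L1_measurable i2.
apply: ae_eq_integral => //.
- by apply/measurable_EFinP; apply: measurable_funM => //; exact: measurable_kernel_l.
- by apply/measurable_EFinP; apply: measurable_funM => //; exact: measurable_kernel_l.
- by apply: filterS h12 => y -> _.
Qed.

Lemma int_op_linear (a b : R) h1 h2 : L1 mu h1 -> L1 mu h2 ->
  Defs.ae_eq mu (int_op mu K (fun x => a * h1 x + b * h2 x))
                (fun x => a * int_op mu K h1 x + b * int_op mu K h2 x).
Proof.
move=> i1 i2; apply: filterS2 (int_op_ae i1) (int_op_ae i2) => x j1 j2.
have E : (fun y => K (x, y) * (a * h1 y + b * h2 y)) =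
    (fun y => a * (K (x, y) * h1 y) + b * (K (x, y) * h2 y)).
  by apply/funext => y; ring.
have := RintD (L1Z a j1) (L1Z b j2); rewrite !RintZ// -E.
by [].
Qed.

Lemma int_op_ge0 h : L1 mu h -> {ae mu, forall x, 0 <= h x} ->
  {ae mu, forall x, 0 <= int_op mu K h x}.
Proof.
move=> h1 h0; apply: aeW => x; rewrite /int_op fine_ge0//.
have mh := L1_measurable h1.
rewrite (ae_eq_integral (fun y => (K (x, y) * `|h y|)%:E))//.
- by apply: integral_ge0 => y _; rewrite lee_fin mulr_ge0.
- by apply/measurable_EFinP; apply: measurable_funM => //; exact: measurable_kernel_l.
- apply/measurable_EFinP; apply: measurable_funM => //; first exact: measurable_kernel_l.
  exact: measurableT_comp.
- by apply: filterS h0 => y y0 _; rewrite ger0_norm.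
Qed.

End subkernel.

Lemma sds_kernel_op K : sds_kernel mu K -> semi_doubly_stochastic mu (int_op mu K).
Proof.
move=> [mK K0 Kcol Krow].
have K1 : {ae mu, forall y, (\int[mu]_x (K (x, y))%:E <= 1)%E}.
  by apply: filterS Kcol => y ->.
split.
- by move=> h; exact: int_op_L1.
- by move=> h1 h2; exact: int_op_ae_eq.
- by move=> a b h1 h2; exact: int_op_linear.
- by move=> h; exact: int_op_ge0.
split.
  move=> h h1; rewrite integral_int_op//; apply: ae_eq_integral => //.
  - apply/measurable_EFinP; apply: measurable_funM; last exact: L1_measurable h1.
    exact: measurable_col_mass.
  - exact: measurable_int h1.
  - by apply: filterS Kcol => y y1 _; rewrite /col_mass y1 mul1r.
(* The adjoint of [\1_E] is the column mass of the rows in [E]. By Tonelli its integral adds up the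
   row masses over [E], each at most 1. *)
move=> E mE Eoo; pose KE z := \1_E z.1 * K z.
have mKE : measurable_fun setT KE.
  apply: measurable_funM => //.
  by apply: measurableT_comp measurable_fst; exact: measurable_indic.
have I01 x : 0 <= (\1_E x : R) <= 1 by rewrite indicE; case: (_ \in _); rewrite ?lexx ?ler01.
have KE0 z : 0 <= KE z by case/andP: (I01 z.1) => ? _; rewrite mulr_ge0.
have KE1 : {ae mu, forall y, (\int[mu]_x (KE (x, y))%:E <= 1)%E}.
  apply: filterS K1 => y; apply: le_trans; apply: ge0_le_integral => //.
  - by move=> x _; rewrite lee_fin.
  - by apply/measurable_EFinP; exact: measurable_kernel_r.
  - by apply/measurable_EFinP; exact: measurable_kernel_r.
  - by move=> x _; rewrite lee_fin /KE ler_piMl//; case/andP: (I01 x).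
exists (col_mass KE); split.
- split; first exact: measurable_col_mass.
  exists 1; apply: filterS (col_mass_le1 KE0 KE1) => y y1.
  by rewrite ger0_norm// col_mass_ge0.
- move=> h h1; rewrite -integral_int_op//; apply: eq_integral => x _; congr EFin.
  rewrite /int_op /KE/= indicE; case: (_ \in _); rewrite ?mul1r ?mul0r.
    by under eq_integral do rewrite mul1r.
  by under eq_integral do rewrite !mul0r; rewrite integral0.
- rewrite (ae_eq_integral (fun y => \int[mu]_x (KE (x, y))%:E)%E)//; last 3 first.
  + by apply/measurable_EFinP; exact: measurable_col_mass.
  + exact: measurable_col_integral.
  + by apply: filterS (col_massE KE0 KE1) => y -> _.
  rewrite -(fubini_tonelli (fun z => (KE z)%:E))/=; last 2 first.
  + exact/measurable_EFinP.
  + by move=> z; rewrite lee_fin.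
  rewrite -[leRHS]mul1e -integral_cst// [leRHS]integral_mkcond.
  apply: ae_ge0_le_integral => //.
  + by move=> x _; apply: integral_ge0 => y _; rewrite lee_fin.
  + apply: (measurable_fun_fubini_tonelli_F (fun z => (KE z)%:E)) => //.
    exact/measurable_EFinP.
  + by move=> x _; apply: erestrict_ge0.
  + by apply/(measurable_restrictT _ _).1.
  apply: filterS Krow => x x1 _; rewrite patchE.
  rewrite /KE/= indicE; case: (_ \in _).
    by under eq_integral do rewrite mul1r.
  by under eq_integral do rewrite mul0r; rewrite integral0.
Qed.

End kernel_operators.

(** * Semi-doubly stochastic operators decrease the excess *)

Section semi_doubly_stochastic_excess.
Context {d : measure_display} {T : measurableType d} {R : realType}.
Variable mu : {measure set T -> \bar R}.
Implicit Types (h k : T -> R).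

Lemma le_Rint_ae h k : L1 mu h -> L1 mu k -> {ae mu, forall x, h x <= k x} ->
  \int[mu]_x h x <= \int[mu]_x k x.
Proof.
move=> ih ik hk; rewrite -subr_ge0 -RintB//.
have ikh := L1B ik ih.
rewrite -lee_fin -L1_EFin// (ae_eq_integral (fun x => `|k x - h x|%:E))//.
- by apply: integral_ge0 => x _; rewrite lee_fin.
- exact: measurable_int ikh.
- exact: measurable_int (L1_norm ikh).
- by apply: filterS hk => x hkx _; rewrite ger0_norm// subr_ge0.
Qed.

Lemma eq_Rint_ae h k : L1 mu h -> L1 mu k -> {ae mu, forall x, h x = k x} ->
  \int[mu]_x h x = \int[mu]_x k x.
Proof.
move=> ih ik hk; apply/eqP; rewrite eq_le !le_Rint_ae//.
- by apply: filterS hk => x ->.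
- by apply: filterS hk => x ->.
Qed.

Lemma L1_pospart h u : 0 <= u -> L1 mu h -> L1 mu (fun x => Num.max (h x - u) 0).
Proof.
move=> u0 h1; apply: (L1_dominated _ _ (L1_norm h1)).
  exact/measurable_pospart/L1_measurable/h1.
move=> x; rewrite ger0_norm ?le_max ?lexx ?orbT// ge_max normr_ge0 andbT.
by rewrite lerBlDr (le_trans (ler_norm _))// lerDl.
Qed.

Lemma L1_indic A : measurable A -> (mu A < +oo)%E -> L1 mu (\1_A : T -> R).
Proof.
move=> mA Aoo; apply: L1_ge0P; first exact: measurable_indic.
  by move=> x; rewrite indicE.
by rewrite integral_indic// setIT.
Qed.

Lemma Rint_indic A : measurable A -> \int[mu]_x (\1_A x : R) = fine (mu A).
Proof. by move=> mA; rewrite /Rintegral integral_indic// setIT. Qed.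

Lemma L1_gtset_lty h u : 0 < u -> L1 mu h -> (mu [set x | (u < h x)%R] < +oo)%E.
Proof.
move=> u0 h1; have mh := L1_measurable h1.
have mE := measurable_gtset u mh.
have : L1 mu (\1_[set x | u < h x] : T -> R).
  apply: (L1_dominated _ _ (L1Z u^-1 (L1_norm h1))); first exact: measurable_indic.
  move=> x; rewrite indic_set ger0_norm//; have [ux|_] := ltP u (h x).
    by rewrite ler_pdivlMl// mulr1 (le_trans (ltW ux))// ler_norm.
  by rewrite mulr_ge0// invr_ge0 ltW.
by move=> /(@integrable_lty _ _ _ mu _ measurableT); rewrite integral_indic// setIT.
Qed.

Lemma L1_indicM A h : measurable A -> L1 mu h -> L1 mu (fun x => \1_A x * h x).
Proof.
move=> mA h1; apply: (L1_dominated _ _ (L1_norm h1)).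
  by apply: measurable_funM; [exact: measurable_indic|exact: L1_measurable h1].
move=> x; rewrite normrM indicE; case: (_ \in _) => /=.
  by rewrite normr1 mul1r.
by rewrite normr0 mul0r.
Qed.

(** Tested on the indicator of a piece of the set where [psi < 0], the adjoint has an integral that
    is nonpositive by choice of the set and nonnegative by positivity of [S]. Such indicators are in
    L^1 only on pieces of finite measure, and sigma-finiteness supplies enough of them. *)
Lemma adjoint_ge0 S E (psi : T -> R) : sigma_finite setT mu ->
  semi_doubly_stochastic mu S -> measurable E -> measurable_fun setT psi ->
  (forall h, L1 mu h ->
    (\int[mu]_x (psi x * h x)%:E = \int[mu]_x (\1_E x * S h x)%:E)%E) ->
  {ae mu, forall x, 0 <= psi x}.
Proof.
move=> [F FT FP] [SL1 _ _ S0 _] mE mpsi adj.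
have mF n := (FP n).1; have Foo n := (FP n).2.
have m0 : measurable [set x | psi x < 0].
  rewrite (_ : [set x | _] = [set x | 0 < - psi x]); last first.
    by apply/funext => x /=; rewrite oppr_gt0.
  by apply: measurable_gtset; exact: measurableT_comp.
pose A n := [set x | psi x < 0] `&` F n.
have mA n : measurable (A n) by exact: measurableI.
have Aoo n : (mu (A n) < +oo)%E.
  by apply: le_lt_trans (Foo n); rewrite le_measure ?inE//; exact: subIsetr.
have negA n : mu.-negligible (A n).
  have iA := L1_indic (mA n) (Aoo n).
  have mpA : measurable_fun setT (fun x => (psi x * \1_(A n) x)%:E).
    by apply/measurable_EFinP; apply: measurable_funM => //; exact: measurable_indic.
  have I0 : (\int[mu]_x `|(psi x * \1_(A n) x)%:E| = 0)%E.
    apply/eqP; rewrite eq_le; apply/andP; split; last exact: integral_ge0.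
    rewrite -oppe_ge0 -integral_ge0N//.
    rewrite (eq_integral (fun x => (psi x * \1_(A n) x)%:E)); last first.
      move=> x _ /=; rewrite indicE.
      have [/set_mem[/= p0 _]|_] := boolP (x \in A n).
        by rewrite mulr1 ltr0_norm// opprK.
      by rewrite mulr0 normr0 oppr0.
    rewrite adj//.
    have /(S0 _ iA) SA0 : {ae mu, forall x, 0 <= (\1_(A n) x : R)}.
      by apply: aeW => x; rewrite indicE.
    have iS := L1_indicM mE (SL1 _ iA).
    rewrite L1_EFin// lee_fin.
    have /= := @le_Rint_ae (fun=> 0) _ (integrable0 _ _) iS.
    rewrite Rintegral_cst// mul0r; apply.
    by apply: filterS SA0 => x x0; rewrite mulr_ge0// indicE.
  move/(ae_eq_integral_abs _ measurableT mpA): I0.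
  apply: negligibleS => x [/= p0 Fx] /(_ I).
  rewrite indicE mem_set//= mulr1 => -[p00].
  by rewrite p00 ltxx in p0.
apply: negligibleS (negligible_bigcup negA) => x /= /negP; rewrite -ltNge => p0.
have : setT x by []; rewrite FT => -[n _ Fx].
by exists n.
Qed.

Lemma sds_excess S (f : T -> R) u : sigma_finite setT mu -> semi_doubly_stochastic mu S ->
  L1 mu f -> (forall x, 0 <= f x) -> 0 < u ->
  \int[mu]_x (Num.max (S f x - u) 0) <= \int[mu]_x (Num.max (f x - u) 0).
Proof.
move=> sf sS f1 f0 u0.
have [SL1 Sae Slin S0 [Sint Sadj]] := sS.
have mf := L1_measurable f1.
pose e x := Num.max (f x - u) 0; pose m x := f x - e x.
have e1 : L1 mu e by exact: L1_pospart (ltW u0) f1.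
have m1 : L1 mu m by exact: L1B.
have mlu x : m x <= u by rewrite /m /e; case: (leP (f x - u)) => h; lra.
have m0 x : 0 <= m x by rewrite /m /e; case: (leP (f x - u)) => h; have := f0 x; lra.
have e0 x : 0 <= e x by rewrite le_max lexx orbT.
have fE : f = (fun x => 1 * m x + 1 * e x).
  by apply/funext => x; rewrite !mul1r /m subrK.
have iSf := SL1 _ f1; have iSe := SL1 _ e1; have iSm := SL1 _ m1.
pose E := [set x | u < S f x].
have mE : measurable E by apply: measurable_gtset; exact: L1_measurable iSf.
have Eoo : (mu E < +oo)%E := L1_gtset_lty u0 iSf.
have [psi [[mpsi _] adj psiE]] := Sadj _ mE Eoo.
have psi0 := adjoint_ge0 sf sS mE mpsi adj.
(* An everywhere nonnegative representative of [psi]; the bound on its integral then places it in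
   L^1. *)
pose q x := Num.max (psi x) 0.
have mq : measurable_fun setT q by exact: measurable_maxr.
have q0 x : 0 <= q x by rewrite le_max lexx orbT.
have qpsi : {ae mu, forall x, q x = psi x}.
  by apply: filterS psi0 => x x0; rewrite /q max_l.
have qE : (\int[mu]_x (q x)%:E <= mu E)%E.
  rewrite (ae_eq_integral (fun x => (psi x)%:E))//; [exact/measurable_EFinP..|].
  by apply: filterS qpsi => x -> _.
have q1 : L1 mu q by apply: L1_ge0P => //; exact: le_lt_trans qE Eoo.
have muE : (mu E)%E = (fine (mu E))%:E by rewrite fineK// ge0_fin_numE.
have Jq : \int[mu]_x q x <= fine (mu E) by rewrite -lee_fin -L1_EFin// -muE.
have qm1 : L1 mu (fun x => q x * m x).
  apply: (L1_dominated _ _ (L1Z u q1)).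
    by apply: measurable_funM => //; exact: L1_measurable m1.
  by move=> x; rewrite ger0_norm ?mulr_ge0// mulrC ler_wpM2r.
(* The truncated part costs at most [u * mu E], exactly what subtracting [u] on [E] takes away
   again. *)
have ESm : \int[mu]_x (\1_E x * S m x) <= u * fine (mu E).
  apply: le_trans (_ : \int[mu]_x (q x * m x) <= _).
    rewrite -lee_fin -!L1_EFin//; last exact: L1_indicM.
    rewrite -adj// (ae_eq_integral (fun x => (q x * m x)%:E))//.
    - apply/measurable_EFinP; apply: measurable_funM => //; exact: L1_measurable m1.
    - exact: measurable_int qm1.
    - by apply: filterS qpsi => x -> _.
  apply: le_trans (ler_wpM2l (ltW u0) Jq); rewrite -RintZ//.
  apply: le_Rint => //; first exact: L1Z.
  by move=> x; rewrite mulrC ler_wpM2r.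
have ESe : \int[mu]_x (\1_E x * S e x) <= \int[mu]_x e x.
  have -> : \int[mu]_x e x = \int[mu]_x S e x.
    by rewrite /Rintegral Sint.
  apply: le_Rint_ae => //; first exact: L1_indicM.
  apply: filterS (S0 _ e1 (aeW _ e0)) => x x0.
  by rewrite ler_piMl// indicE; case: (_ \in _).
have -> : \int[mu]_x (Num.max (S f x - u) 0) =
    \int[mu]_x (\1_E x * S m x) + \int[mu]_x (\1_E x * S e x) - u * fine (mu E).
  have i1 := L1_indicM mE iSm; have i2 := L1_indicM mE iSe.
  have i3 := L1_indic mE Eoo.
  rewrite -(Rint_indic mE) -(RintD i1 i2) -(RintZ _ i3) -(RintB (L1D i1 i2) (L1Z _ i3)).
  apply: eq_Rint_ae.
  - exact: L1_pospart (ltW u0) iSf.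
  - exact: L1B (L1D i1 i2) (L1Z _ i3).
  have := Slin 1 1 _ _ m1 e1; rewrite -fE; apply: filterS => x SE.
  rewrite indic_set SE !mul1r; case: (ltP u) => h /=.
    by rewrite max_l ?subr_ge0 ?(ltW h)//; lra.
  by rewrite max_r ?subr_le0//; lra.
lra.
Qed.

Lemma sds_limit_excess (S : nat -> (T -> R) -> (T -> R)) (f g : T -> R) :
  sigma_finite setT mu -> (forall n, semi_doubly_stochastic mu (S n)) ->
  L1 mu f -> L1 mu g -> (forall x, 0 <= f x) -> L1_cvg mu (fun n => S n f) g ->
  (forall u, 0 < u ->
    \int[mu]_x (Num.max (g x - u) 0) <= \int[mu]_x (Num.max (f x - u) 0)) /\
  \int[mu]_x g x = \int[mu]_x f x.
Proof.
move=> sf sS f1 g1 f0 Sg.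
have iS n : L1 mu (S n f) by case: (sS n) => + _ _ _ _; apply.
have iSg n : L1 mu (fun x => `|S n f x - g x|) by apply/L1_norm/L1B.
have JS n : \int[mu]_x S n f x = \int[mu]_x f x.
  by case: (sS n) => _ _ _ _ [+ _] => /(_ _ f1) E; rewrite /Rintegral E.
(* The excess and the integral both move by at most the L^1 distance, so both claims reduce to
   this. *)
have lim0 c : (forall n, c <= \int[mu]_x `|S n f x - g x|) -> c <= 0.
  move=> cS; rewrite leNgt; apply/negP => c0.
  have /fine_cvgP[_] := Sg; move/(cvgr_lt _) => /(_ c c0)[N _ /(_ N (leqnn N))] /=.
  by apply/negP; rewrite -leNgt; exact: cS.
split=> [u u0|].
  rewrite -subr_le0; apply: lim0 => n.
  have := sds_excess sf (sS n) f1 f0 u0.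
  suff : \int[mu]_x (Num.max (g x - u) 0) <=
      \int[mu]_x (Num.max (S n f x - u) 0) + \int[mu]_x `|S n f x - g x|.
    by lra.
  have iSu := L1_pospart (ltW u0) (iS n).
  rewrite -RintD//; apply: le_Rint; [exact: L1_pospart (ltW u0) g1|exact: L1D|].
  move=> x; have := ler_norm (g x - S n f x); rewrite distrC => h.
  have := normr_ge0 (S n f x - g x).
  by case: (leP (g x - u)) => h1; case: (leP (S n f x - u)) => h2; lra.
apply/eqP; rewrite -subr_eq0 -normr_eq0 eq_le normr_ge0 andbT; apply: lim0 => n.
by rewrite -(JS n) distrC -RintB//; apply: le_normr_Rintegral => //; exact: L1B.
Qed.

End semi_doubly_stochastic_excess.

(** * Convex functions as combinations of positive parts *)

Section convex_interpolation.
Context {R : realType}.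
Variable phi : R -> R.
Hypothesis adm : admissible_phi phi.

Let phi0 : phi 0 = 0. Proof. by case: adm. Qed.
Let phi_ge0 x : 0 <= x -> 0 <= phi x. Proof. by case: adm => _ + _ _; exact. Qed.
Let phi_homo x y : 0 <= x -> x <= y -> phi x <= phi y.
Proof. by case: adm => _ _ + _; exact. Qed.

(** Convexity without denominators: it covers [x = z] and can be handed directly to linear
    arithmetic. *)
Lemma admissible_chord x y z : 0 <= x -> x <= y -> y <= z ->
  (z - x) * phi y <= (z - y) * phi x + (y - x) * phi z.
Proof.
move=> x0 xy yz; have [zx|] := eqVneq z x.
  have -> : y = x by lra.
  by rewrite zx !subrr !mul0r addr0.
rewrite neq_lt => /orP[?|xz]; first by exfalso; lra.
have zx0 : 0 < z - x by rewrite subr_gt0.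
pose t := (z - y) / (z - x).
have t01 : 0 <= t <= 1.
  by rewrite /t divr_ge0 ?subr_ge0 ?(ltW xz)//= ler_pdivrMr// mul1r lerD2l lerN2.
have tE : t * (z - x) = z - y by rewrite /t divfK// gt_eqF.
have [_ _ _ cvx] := adm.
have := cvx x z t x0 (le_trans x0 (ltW xz)) t01.
have -> : t * x + (1 - t) * z = y by lra.
rewrite -(ler_pM2l zx0) => /le_trans; apply.
have -> : (z - x) * (t * phi x + (1 - t) * phi z) =
    (t * (z - x)) * phi x + (z - x - t * (z - x)) * phi z by ring.
by rewrite tE (_ : z - x - (z - y) = y - x)//; ring.
Qed.

Variable dl : R.
Hypothesis dl0 : 0 < dl.

Definition slope k : R := (phi (k.+1%:R * dl) - phi (k%:R * dl)) / dl.
Definition slope_incr k : R := if k is j.+1 then slope k - slope j else slope 0.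
(** On the half-line this is the piecewise linear interpolation of [phi] at the points [k%:R * dl]
    with [k <= N], continued with its last slope. It is written with positive parts because for
    these the comparison of [g] and [f] is known. *)
Definition interpolant N (y : R) : R :=
  \sum_(k < N) slope_incr k * Num.max (y - k%:R * dl) 0.

Let slopeE k : slope k * dl = phi (k.+1%:R * dl) - phi (k%:R * dl).
Proof. by rewrite /slope divfK// gt_eqF. Qed.

Let grid_ge0 k : 0 <= k%:R * dl. Proof. by rewrite mulr_ge0// ltW. Qed.
Let gridS k : k.+1%:R * dl = k%:R * dl + dl.
Proof. by rewrite -natr1 mulrDl mul1r. Qed.

Lemma slope_ge0 k : 0 <= slope k.
Proof.
rewrite /slope divr_ge0 ?(ltW dl0)// subr_ge0 phi_homo//.
by rewrite gridS lerDl ltW.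
Qed.

Lemma slope_incr_ge0 k : 0 <= slope_incr k.
Proof.
case: k => [|k] /=; first exact: slope_ge0.
rewrite -(pmulr_lge0 _ dl0) mulrBl !slopeE.
have := @admissible_chord (k%:R * dl) (k.+1%:R * dl) (k.+2%:R * dl) (grid_ge0 k).
rewrite !gridS; move: (k%:R * dl) => y /(_ _ _)/=.
have d1 : y <= y + dl by rewrite lerDl ltW.
have d2 : y + dl <= y + dl + dl by rewrite lerDl ltW.
move=> /(_ d1 d2) => h; have : dl * (2 * phi (y + dl)) <= dl * (phi y + phi (y + dl + dl)) by lra.
by rewrite ler_pM2l//; lra.
Qed.

Lemma interpolant_ge0 N y : 0 <= interpolant N y.
Proof.
by apply: sumr_ge0 => k _; rewrite mulr_ge0 ?slope_incr_ge0// le_max lexx orbT.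
Qed.

Lemma interpolant_top N y : N%:R * dl <= y ->
  interpolant N.+1 y = phi (N%:R * dl) + slope N * (y - N%:R * dl).
Proof.
elim: N => [|N IH] Ny.
  rewrite /interpolant big_ord1/= mul0r phi0 add0r subr0 max_l//.
  by move: Ny; rewrite mul0r.
rewrite /interpolant big_ord_recr -/(interpolant N.+1 y) IH/=; last first.
  by apply: le_trans Ny; rewrite gridS lerDl ltW.
rewrite max_l ?subr_ge0//.
have := slopeE N; rewrite gridS => sE.
by move: Ny; rewrite gridS => Ny; lra.
Qed.

Lemma interpolant_stable N y : y <= N%:R * dl ->
  interpolant N.+1 y = interpolant N y.
Proof.
move=> yN; rewrite /interpolant big_ord_recr/= max_r ?mulr0 ?addr0//.
by rewrite subr_le0.
Qed.

(** Inside a cell the secant lies above [phi], but past the cell it lies below; advancing the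
    argument by [dl] always leaves the cell. *)
Lemma interpolant_le N y : 0 <= y -> interpolant N y <= phi (y + dl).
Proof.
move=> y0; elim: N => [|N IH].
  by rewrite /interpolant big_ord0 phi_ge0// addr_ge0// ltW.
have [yN|/ltW Ny] := leP y (N%:R * dl); first by rewrite interpolant_stable.
rewrite interpolant_top//.
have := @admissible_chord (N%:R * dl) (N.+1%:R * dl) (y + dl) (grid_ge0 N).
have := slopeE N; have := slope_ge0 N; have := dl0.
rewrite gridS; move: (N%:R * dl) Ny => a ay d0 s0 sE.
have d1 : a <= a + dl by rewrite lerDl ltW.
have d2 : a + dl <= y + dl by rewrite lerD2r.
move=> /(_ d1 d2) h.
have E : (y + dl - a) * (slope N * dl) <= dl * (phi (y + dl) - phi a).
  by rewrite sE; lra.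
have : dl * ((y + dl - a) * slope N) <= dl * (phi (y + dl) - phi a) by lra.
rewrite ler_pM2l// => E2.
have : 0 <= dl * slope N by rewrite mulr_ge0// ltW.
by lra.
Qed.

Lemma interpolant_ge N y : 0 <= y -> y <= N%:R * dl -> phi y <= interpolant N y.
Proof.
move=> y0; elim: N => [|N IH].
  rewrite mul0r => y0'; have -> : y = 0 by lra.
  by rewrite phi0 interpolant_ge0.
have [yN _|/ltW Ny yN] := leP y (N%:R * dl).
  by rewrite interpolant_stable// IH.
rewrite interpolant_top//.
have := @admissible_chord (N%:R * dl) y (N.+1%:R * dl) (grid_ge0 N) Ny yN.
have := slopeE N; rewrite gridS; move: (N%:R * dl) Ny => a ay sE h.
have : dl * phi y <= dl * (phi a + slope N * (y - a)).
  have : (y - a) * (slope N * dl) = (y - a) * (phi (a + dl) - phi a) by rewrite sE.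
  by lra.
by rewrite ler_pM2l.
Qed.

Lemma interpolant_neg N y : y <= 0 -> interpolant N y = 0.
Proof.
move=> y0; apply: big1 => k _; rewrite max_r ?mulr0//.
by rewrite subr_le0 (le_trans y0).
Qed.

End convex_interpolation.

(** * Comparison of convex integrals *)

Section convex_comparison.
Context {d : measure_display} {T : measurableType d} {R : realType}.
Variable mu : {measure set T -> \bar R}.
Variables f g : T -> R.
Hypotheses (f1 : L1 mu f) (g1 : L1 mu g).
Hypotheses (f0 : forall x, 0 <= f x) (g0 : forall x, 0 <= g x).

Lemma measurable_admissible (phi : R -> R) (h : T -> R) : admissible_phi phi ->
  measurable_fun setT h -> (forall x, 0 <= h x) ->
  measurable_fun setT (fun x => phi (h x)).
Proof.
move=> [_ _ phi_homo _] mh h0.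
rewrite (_ : (fun x => phi (h x)) = (fun y => phi (Num.max y 0)) \o h); last first.
  by apply/funext => x /=; rewrite max_l.
apply: measurableT_comp => //; apply: nondecreasing_measurable => // x y xy.
apply: phi_homo; first by rewrite le_max lexx orbT.
by rewrite ge_max !le_max lexx orbT andbT xy.
Qed.

Lemma excess_le_convex :
  (forall u, 0 < u -> (\int[mu]_x (Num.max (g x - u) 0)%:E <=
                      \int[mu]_x (Num.max (f x - u) 0)%:E)%E) ->
  forall phi : R -> R, admissible_phi phi ->
  (\int[mu]_x (phi (g x))%:E <= \int[mu]_x (phi (f x))%:E)%E.
Proof.
move=> gf phi adm; have [phi0 phi_ge0 phi_homo phi_cvx] := adm.
have mf := L1_measurable f1; have mg := L1_measurable g1.
pose dl n : R := n.+1%:R^-1.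
have dl0 n : 0 < dl n by rewrite invr_gt0.
(* The shift by one cell puts the interpolant below [phi] and also moves every kink to a positive
   level, where the hypothesis applies. With cells of width [dl n], this number of them covers
   [[0, n.+1]]. *)
pose I n x := interpolant phi (dl n) (n.+1 * n.+1)%N (x - dl n).
have I0 n x : 0 <= I n x by exact: interpolant_ge0.
have IE n x : I n x = \sum_(k < (n.+1 * n.+1)%N)
    slope_incr phi (dl n) k * Num.max (x - k.+1%:R * dl n) 0.
  apply: eq_bigr => k _; congr (_ * Num.max _ _).
  by rewrite -natr1 mulrDl mul1r opprD addrA addrAC.
have mI n (h : T -> R) : measurable_fun setT h -> measurable_fun setT (fun x => I n (h x)).
  move=> mh; under eq_fun do rewrite IE.
  apply: measurable_sum => k; apply: measurable_funM => //.
  exact: measurable_pospart.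
have intI n (h : T -> R) : measurable_fun setT h -> (\int[mu]_x (I n (h x))%:E =
    \sum_(k < (n.+1 * n.+1)%N) (slope_incr phi (dl n) k)%:E *
      \int[mu]_x (Num.max (h x - k.+1%:R * dl n) 0)%:E)%E.
  move=> mh; under eq_integral do rewrite IE -sumEFin.
  rewrite ge0_integral_sum//.
  - apply: eq_bigr => k _; under eq_integral do rewrite EFinM.
    rewrite ge0_integralZl//.
    + by apply/measurable_EFinP; exact: measurable_pospart.
    + by move=> x _; rewrite lee_fin le_max lexx orbT.
    + by rewrite lee_fin slope_incr_ge0.
  - move=> k; apply/measurable_EFinP; apply: measurable_funM => //.
    exact: measurable_pospart.
  - move=> k x _; rewrite lee_fin mulr_ge0 ?slope_incr_ge0//.
    by rewrite le_max lexx orbT.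
have Ile n x : 0 <= x -> I n x <= phi x.
  move=> x0; have [xd|/ltW xd] := leP x (dl n).
    by rewrite /I interpolant_neg ?subr_le0// phi_ge0.
  by have := @interpolant_le _ _ adm _ (dl0 n) (n.+1 * n.+1)%N (x - dl n);
     rewrite subrK subr_ge0; apply.
have dlcvg : dl @ \oo --> 0 by exact: cvg_harmonic.
have Icvg x : 0 <= x -> I n x @[n --> \oo] --> phi x.
  rewrite le_eqVlt => /predU1P[<-|x0].
    apply: cvg_near_cst; apply: nearW => n.
    by rewrite phi0 /I sub0r interpolant_neg// oppr_le0 ltW.
  (* Convexity on [x - dl n], [x], [x + 1] bounds the loss caused by the shift. *)
  apply: (@squeeze_cvgr _ _ _ _ (fun n => phi x - dl n * (phi (x + 1) - phi x)) (cst (phi x))).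
  - near=> n; rewrite Ile ?(ltW x0)// andbT.
    have dx : dl n < x by near: n; apply: (cvgr_lt _ dlcvg).
    have nx : x <= n.+1%:R.
      near: n; have := nbhs_infty_ger x; apply: filterS => n xn.
      by apply: le_trans xn _; rewrite ler_nat.
    have xd0 : 0 <= x - dl n by rewrite subr_ge0 ltW.
    apply: (@le_trans _ _ (phi (x - dl n))); last first.
      apply: interpolant_ge => //.
      rewrite natrM -mulrA /dl mulfV ?mulr1 ?pnatr_eq0//.
      by apply: le_trans nx; rewrite lerBlDr lerDl ltW.
    have := dl0 n => d0.
    have := @admissible_chord _ _ adm (x - dl n) x (x + 1) xd0.
    move=> /(_ _ _)/= => h.
    have l1 : x - dl n <= x by lra.
    have l2 : x <= x + 1 by lra.
    by have := h l1 l2; lra.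
  - rewrite -[X in _ --> X]subr0; apply: cvgB; first exact: cvg_cst.
    rewrite -[X in _ --> X](mul0r (phi (x + 1) - phi x)).
    by apply: cvgM => //; exact: cvg_cst.
  - exact: cvg_cst.
apply: (@fatou_bound _ _ _ mu (fun n x => I n (g x))).
- by move=> n; exact: mI.
- by [].
- by move=> x; exact: Icvg.
move=> n; apply: (@le_trans _ _ (\int[mu]_x (I n (f x))%:E)%E).
  rewrite !intI//; apply: lee_sum => k _; apply: lee_wpmul2l.
    by rewrite lee_fin slope_incr_ge0.
  by apply: gf; rewrite mulr_gt0.
apply: ge0_le_integral => //.
- by move=> x _; rewrite lee_fin.
- by apply/measurable_EFinP; exact: mI.
- by apply/measurable_EFinP; exact: measurable_admissible.
- by move=> x _; rewrite lee_fin Ile.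
Unshelve. all: by end_near. Qed.

Lemma admissible_pospart (u : R) : 0 <= u ->
  admissible_phi (fun x : R => Num.max (x - u) 0).
Proof.
move=> u0; split.
- by rewrite sub0r max_r// oppr_le0.
- by move=> x _; rewrite le_max lexx orbT.
- by move=> x y _ xy; rewrite ge_max !le_max lexx orbT andbT lerD2r xy.
- move=> x y t _ _ /andP[t0 t1].
  have h1 : x - u <= Num.max (x - u) 0 by rewrite le_max lexx.
  have h2 : 0 <= Num.max (x - u) 0 by rewrite le_max lexx orbT.
  have h3 : y - u <= Num.max (y - u) 0 by rewrite le_max lexx.
  have h4 : 0 <= Num.max (y - u) 0 by rewrite le_max lexx orbT.
  have t2 : 0 <= 1 - t by lra.
  rewrite ge_max; apply/andP; split.
    have := ler_wpM2l t0 h1; have := ler_wpM2l t2 h3; lra.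
  by rewrite addr_ge0// mulr_ge0.
Qed.

End convex_comparison.

(** * Decreasing rearrangement and excess *)

Section layer_cake.
Context {d : measure_display} {Y : measurableType d} {R : realType}.
Variable nu : {sigma_finite_measure set Y -> \bar R}.
Local Notation leb := (@lebesgue_measure R).
Local Open Scope ereal_scope.

(** Extended values and a general space make this usable both for [h] under [mu] and for its
    rearrangement under Lebesgue measure. The proof measures the region [W] under the graph and
    above [u] in two ways. *)
Lemma layer_cake (k : Y -> \bar R) (u : R) : measurable_fun setT k ->
  \int[nu]_y maxe (k y - u%:E) 0 =
  \int[leb]_(t in `[u, +oo[) nu [set y | t%:E < k y].
Proof.
move=> mk; pose GR := measurableTypeR R.
pose W := [set p : Y * GR | (u <= p.2)%R /\ p.2%:E < k p.1].
have mW : measurable W.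
  have -> : W = ((fun p : Y * GR => (u <= p.2)%R) @^-1` [set true]) `&`
      (setT `&` [set p : Y * GR | 0 < k p.1 - p.2%:E]).
    apply/seteqP; split=> p.
    - by move=> [? ?]; split => //; split => //; rewrite /mkset sube_gt0.
    - by move=> [? [_]]; rewrite /mkset sube_gt0.
  apply: measurableI.
  - have : measurable_fun setT (fun p : Y * GR => (u <= p.2)%R).
      exact: measurable_fun_ler.
    by move=> /(_ measurableT [set true]); rewrite setTI; exact.
  - apply: emeasurable_fun_o_infty => //; apply: emeasurable_funB.
      exact: measurableT_comp mk measurable_fst.
    by apply/measurable_EFinP; exact: measurable_snd.
have mW1 y : measurable [set t : GR | W (y, t)].
  have := measurable_xsection y mW; congr measurable.
  by apply/seteqP; split => t /=; rewrite /xsection/= inE.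
have mW2 (t : GR) : measurable [set y | W (y, t)].
  have := measurable_ysection t mW; congr measurable.
  by apply/seteqP; split => y /=; rewrite /ysection/= inE.
transitivity (\int[nu]_y \int[leb]_t (\1_W (y, t) : R)%:E).
  apply: eq_integral => y _.
  rewrite (eq_integral (fun t => (\1_[set t : GR | W (y, t)] t)%:E)); last first.
    by move=> t _; rewrite !indicE; congr (_%:R%:E); congr nat_of_bool; apply/idP/idP;
       rewrite !inE.
  rewrite integral_indic// setIT.
  have lebE (i : interval R) (A : set R) : A = [set` i] ->
      leb A = (if i.1 < i.2 then (i.2 : \bar R) - i.1 else 0).
    by move=> ->; exact: lebesgue_measure_itv.
  apply/esym; case ky : (k y) => [r| |].
  - apply: etrans.
      apply: (lebE `[u, r[); apply/seteqP; split => t /=; rewrite /W/= ky lte_fin in_itv/=.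
        by move=> [-> ->].
      by move=> /andP[].
    rewrite /= lte_fin; have [ur|ru] := ltP u r.
      by rewrite max_l// lee_fin subr_ge0 ltW.
    by rewrite max_r// lee_fin subr_le0.
  - apply: etrans.
      apply: (lebE `[u, +oo[); apply/seteqP; split => t /=; rewrite /W/= ky in_itv/= andbT.
        by case.
      by move=> ut; rewrite ltry.
    by rewrite /= ltry.
  - rewrite (_ : [set t | _] = set0); last first.
      by apply/seteqP; split => t //=; rewrite /W/= ky => -[].
    by rewrite measure0 /= max_r // leNye.
rewrite (fubini_tonelli (fun p : Y * GR => (\1_W p : R)%:E))//=; last first.
  exact/measurable_EFinP/measurable_indic.
rewrite [RHS]integral_mkcond; apply: eq_integral => t _.
rewrite (eq_integral (fun y => (\1_[set y | W (y, t)] y)%:E)); last first.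
  by move=> y _; rewrite !indicE; congr (_%:R%:E); congr nat_of_bool; apply/idP/idP;
     rewrite !inE.
rewrite integral_indic// setIT patchE.
have [ut|tu] := leP u t.
  rewrite mem_set/= ?in_itv/= ?ut//; congr (nu _).
  by apply/seteqP; split => y /=; rewrite /W/=; [case|].
rewrite memNset/= ?in_itv/= ?andbT ?leNgt ?tu//.
rewrite (_ : [set y | _] = set0) ?measure0//.
by apply/seteqP; split => y //=; rewrite /W/= leNgt tu => -[].
Qed.

End layer_cake.

Section decreasing_rearrangement.
Context {d : measure_display} {T : measurableType d} {R : realType}.
Variable mu : {sigma_finite_measure set T -> \bar R}.
Variable h : T -> R.
Hypothesis h1 : L1 mu h.
Hypothesis h0 : forall x, (0 <= h x)%R.
Local Notation leb := (@lebesgue_measure R).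
Local Open Scope ereal_scope.

Let mh : measurable_fun setT h := L1_measurable h1.

Lemma distfunE t : distfun mu h t = \int[mu]_x ((t < h x)%R%:R)%:E.
Proof.
rewrite (eq_integral (fun x => (\1_[set x | (t < h x)%R] x)%:E)).
  by rewrite integral_indic ?setIT//; exact: measurable_gtset.
by move=> x _; rewrite indic_set.
Qed.

Lemma distfun_homo t t' : (t <= t')%R -> distfun mu h t' <= distfun mu h t.
Proof.
move=> tt'; apply: le_measure; rewrite ?inE; [exact: measurable_gtset..|].
by move=> x /=; exact: le_lt_trans.
Qed.

(** The superlevel sets increase as the level decreases to [t], so Fatou suffices even if their
    measures are infinite. *)
Lemma distfun_rcont t s : (forall t', (t < t')%R -> distfun mu h t' <= s) ->
  distfun mu h t <= s.
Proof.
move=> H; rewrite distfunE.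
apply: (@fatou_bound _ _ _ mu (fun n x => (t + n.+1%:R^-1 < h x)%R%:R)).
- by move=> n; exact: measurable_indic_gt.
- by [].
- move=> x; apply: cvg_near_cst; have [tx|xt] := ltP t (h x).
    have vcvg : (t + n.+1%:R^-1)%R @[n --> \oo] --> t.
      rewrite -[X in _ --> X]addr0; apply: cvgD; first exact: cvg_cst.
      exact: cvg_harmonic.
    near=> n; rewrite (_ : (_ < h x)%R)//.
    by near: n; apply: (cvgr_lt _ vcvg).
  apply: nearW => n; congr (_%:R); congr nat_of_bool; apply/negbTE; rewrite -leNgt.
  by apply: le_trans xt _; rewrite lerDl.
- by move=> n; rewrite -distfunE H// ltrDl.
Unshelve. all: by end_near. Qed.

(* Galois connection between the distribution function and the rearrangement. *)
Lemma decrearr_le r t : (decrearr mu h r <= t%:E) = (distfun mu h t <= r%:E).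
Proof.
apply/idP/idP => [ht|Dt]; last by apply: ereal_inf_lbound; exists t.
apply: distfun_rcont => t' tt'.
have /ereal_inf_lt[_ [t'' /= Dt'' <-]] : decrearr mu h r < t'%:E.
  by apply: le_lt_trans ht _; rewrite lte_fin.
by rewrite lte_fin => /ltW/distfun_homo/le_trans; apply.
Qed.

Lemma decrearr_gt r t : (t%:E < decrearr mu h r) = (r%:E < distfun mu h t).
Proof. by rewrite !ltNge decrearr_le. Qed.

Lemma decrearr_homo r r' : (r <= r')%R -> decrearr mu h r' <= decrearr mu h r.
Proof.
move=> rr'; apply: ereal_inf_le_tmp => _ [t /= Dt <-]; exists t => //=.
by apply: le_trans Dt _; rewrite lee_fin.
Qed.

(** The inequality must be strict: the infimum runs over all real levels, so at [r%:E = mu setT] the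
    rearrangement is [-oo]. *)
Lemma decrearr_ge0 r : r%:E < mu setT -> 0 <= decrearr mu h r.
Proof.
move=> rT; apply: le_ereal_inf_tmp => _ [t /= Dt <-]; rewrite lee_fin leNgt.
apply/negP => t0; move: Dt; rewrite leNgt => /negP; apply.
rewrite /distfun (_ : [set x | _] = setT)//.
by apply/seteqP; split => x //= _; exact: lt_le_trans (h0 x).
Qed.

Lemma measurable_decrearr (D : set R) : measurable_fun D (decrearr mu h).
Proof.
apply: measurable_funTS; apply: (measurability _ (ErealGenOInfty.measurableE R)).
move=> /= _ [_ [t ->]] <-; apply: measurableI => //.
rewrite preimage_itvoy (_ : [set x | _] = [set r | r%:E < distfun mu h t]); last first.
  by apply/seteqP; split => r /=; rewrite decrearr_gt.
case: (distfun mu h t) => [c| |].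
- rewrite (_ : [set r | _] = `]-oo, c[%classic); first exact: measurable_itv.
  by apply/seteqP; split => r /=; rewrite in_itv/= lte_fin.
- by rewrite (_ : [set r | _] = setT)//; apply/seteqP; split => r //= _; rewrite ltry.
- by rewrite (_ : [set r | _] = set0)//; apply/seteqP; split => r.
Qed.

Let I0 := [set r : R | (0 <= r)%R /\ r%:E < mu setT].

Let mI0 : measurable I0.
Proof.
rewrite /I0; case: (mu setT) => [c| |].
- rewrite (_ : [set r | _] = `[0%R, c[%classic); first exact: measurable_itv.
  apply/seteqP; split => r /=; rewrite in_itv/= lte_fin.
    by move=> [-> ->].
  by move=> /andP[].
- rewrite (_ : [set r | _] = `[0%R, +oo[%classic); first exact: measurable_itv.
  apply/seteqP; split => r /=; rewrite in_itv/= andbT; first by case.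
  by move=> r0; rewrite ltry.
- by rewrite (_ : [set r | _] = set0)//; apply/seteqP; split => r // -[].
Qed.

(** Equimeasurability: by the Galois connection the rearrangement exceeds [t] exactly on
    [[0, distfun t)], so the two layer-cake integrals agree level by level. *)
Lemma excess_decrearr u : (0 <= u)%R ->
  \int[leb]_(r in I0) maxe (decrearr mu h r - u%:E) 0 =
  \int[mu]_x (Num.max (h x - u) 0)%:E.
Proof.
move=> u0; pose k := decrearr mu h \_ I0.
have mk : measurable_fun setT k.
  by apply/(measurable_restrictT _ mI0); exact: measurable_decrearr.
transitivity (\int[leb]_r maxe (k r - u%:E) 0).
  rewrite integral_mkcond; apply: eq_integral => r _; rewrite /k !patchE.
  by case: ifP => // _; rewrite max_r// sub0e lee_fin oppr_le0.
transitivity (\int[mu]_x maxe ((h x)%:E - u%:E) 0); last first.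
  by apply: eq_integral => x _; rewrite -EFinB -EFin_max.
rewrite layer_cake; last exact: mk.
rewrite layer_cake; last exact/measurable_EFinP.
apply: eq_integral => t; rewrite inE/= in_itv/= andbT => ut.
have lebE (i : interval R) (A : set R) : A = [set` i] ->
    leb A = (if i.1 < i.2 then (i.2 : \bar R) - i.1 else 0).
  by move=> ->; exact: lebesgue_measure_itv.
have t0 := le_trans u0 ut.
have E : [set r | t%:E < k r] = [set r : R | (0 <= r)%R /\ r%:E < distfun mu h t].
  apply/seteqP; split => r /=; rewrite /k patchE.
    case: ifPn => [/set_mem[r0 rT]|_]; first by rewrite decrearr_gt.
    by rewrite lte_fin ltNge t0.
  move=> [r0 rD]; rewrite mem_set ?decrearr_gt//; split => //.
  by apply: lt_le_trans rD _; apply: le_measure; rewrite ?inE//; exact: measurable_gtset.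
have -> : mu [set y | t%:E < (h y)%:E] = distfun mu h t by [].
apply: etrans (congr1 leb E) _.
have : 0 <= distfun mu h t by [].
case: (distfun mu h t) => [c| |] // c0.
- rewrite (lebE `[0%R, c[); last first.
    apply/seteqP; split => r /=; rewrite in_itv/= lte_fin; first by move=> [-> ->].
    by move=> /andP[].
  rewrite /= lte_fin; move: c0; rewrite lee_fin le_eqVlt => /predU1P[<-|c0].
    by rewrite ltxx.
  by rewrite c0 oppr0 addr0.
- rewrite (lebE `[0%R, +oo[); last first.
    apply/seteqP; split => r /=; rewrite in_itv/= andbT; first by case.
    by move=> r0; rewrite ltry.
  by rewrite /= ltry.
Qed.

Let itv_I0 s : s%:E <= mu setT -> `[0%R, s[ `<=` I0.
Proof.
move=> sT r /=; rewrite in_itv/= => /andP[r0 rs]; split => //.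
by apply: lt_le_trans sT; rewrite lte_fin.
Qed.

Let measurable_exc u (D : set R) :
  measurable_fun D (fun r => maxe (decrearr mu h r - u%:E) 0).
Proof.
apply: measurable_maxe => //; apply: emeasurable_funB => //.
exact: measurable_decrearr.
Qed.

Let integral_add_exc s u : (0 <= s)%R -> (0 <= u)%R ->
  \int[leb]_(r in `[0%R, s[) (u%:E + maxe (decrearr mu h r - u%:E) 0) =
  (u * s)%:E + \int[leb]_(r in `[0%R, s[) maxe (decrearr mu h r - u%:E) 0.
Proof.
move=> s0 u0; rewrite ge0_integralD//.
- rewrite integral_cst//= lebesgue_measure_itv/= lte_fin.
  move: s0; rewrite le_eqVlt => /predU1P[<-|s0]; first by rewrite ltxx mule0 mulr0.
  by rewrite s0 oppr0 addr0.
- by move=> r _; rewrite le_max lexx orbT.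
- exact: measurable_exc.
Qed.

Lemma integral_decrearr_le s u : (0 <= s)%R -> s%:E <= mu setT -> (0 <= u)%R ->
  \int[leb]_(r in `[0%R, s[) decrearr mu h r <=
  (u * s)%:E + \int[mu]_x (Num.max (h x - u) 0)%:E.
Proof.
move=> s0 sT u0; rewrite -excess_decrearr//.
apply: (@le_trans _ _ ((u * s)%:E +
    \int[leb]_(r in `[0%R, s[) maxe (decrearr mu h r - u%:E) 0)); last first.
  rewrite leeD2l//; apply: ge0_subset_integral => //; last exact: itv_I0.
    exact: measurable_exc.
  by move=> r _; rewrite le_max lexx orbT.
rewrite -integral_add_exc//; apply: ge0_le_integral => //.
- by move=> r rs; apply: decrearr_ge0; have [] := itv_I0 sT rs.
- exact: measurable_decrearr.
- by apply: emeasurable_funD => //; exact: measurable_exc.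
- move=> r _; case: (decrearr mu h r) => [c| |]; rewrite ?leNye ?leey//=.
  by rewrite -EFinB -EFin_max -EFinD lee_fin; case: (leP (c - u)%R) => ?; lra.
Qed.

(** Equality case of the previous bound: both estimates used there are sharp when [u] separates the
    values of the rearrangement before and after [s]. *)
Lemma integral_decrearr_eq s u : (0 <= s)%R -> s%:E <= mu setT -> (0 <= u)%R ->
  (forall r, (0 <= r)%R -> (r < s)%R -> u%:E <= decrearr mu h r) ->
  (forall r, (s <= r)%R -> r%:E < mu setT -> decrearr mu h r <= u%:E) ->
  \int[leb]_(r in `[0%R, s[) decrearr mu h r =
  (u * s)%:E + \int[mu]_x (Num.max (h x - u) 0)%:E.
Proof.
move=> s0 sT u0 top bot; rewrite -excess_decrearr//.
transitivity ((u * s)%:E +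
    \int[leb]_(r in `[0%R, s[) maxe (decrearr mu h r - u%:E) 0).
  rewrite -integral_add_exc//; apply: eq_integral => r; rewrite inE/= in_itv/=.
  move=> /andP[r0 rs]; have := top r r0 rs.
  case: (decrearr mu h r) => [c| |] //=; rewrite ?lee_fin => uc.
  by rewrite -EFinB -EFin_max max_l ?subr_ge0// -EFinD addrC subrK.
congr (_ + _); rewrite integral_mkcond [RHS]integral_mkcond.
apply: eq_integral => r _; rewrite !patchE.
have [rs|rs] := boolP (r \in `[0%R, s[%classic).
  by rewrite mem_set//; exact: (itv_I0 sT (set_mem rs)).
case: ifPn => // /set_mem[r0 rT]; rewrite max_r// sube_le0; apply: bot => //.
by move: rs; rewrite notin_setE/= in_itv/= r0/= => /negP; rewrite -leNgt.
Qed.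

Lemma integral_decrearr_full :
  \int[leb]_(r in I0) decrearr mu h r = \int[mu]_x (h x)%:E.
Proof.
transitivity (\int[mu]_x (Num.max (h x - 0) 0)%:E); last first.
  by apply: eq_integral => x _; rewrite subr0 max_l.
rewrite -excess_decrearr//; apply: eq_integral => r /set_mem[r0 rT].
by rewrite sube0 max_l// decrearr_ge0.
Qed.

Lemma decrearr_itvE s :
  \int[leb]_(r in [set r : R | (0 <= r <= s)%R]) decrearr mu h r =
  \int[leb]_(r in `[0%R, s[) decrearr mu h r.
Proof.
rewrite integral_itv_bndo_bndc; last exact: measurable_decrearr.
by congr (integral _ _ _); apply/seteqP; split => r /=; rewrite in_itv.
Qed.

Lemma decrearr_fullE :
  \int[leb]_(r in [set r : R | (0 <= r)%R /\ r%:E <= mu setT]) decrearr mu h r =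
  \int[mu]_x (h x)%:E.
Proof.
rewrite -integral_decrearr_full /I0.
have : 0 <= mu setT by [].
case: (mu setT) => [c| |] // _.
- rewrite (_ : [set r | _ /\ r%:E <= _] = `[0%R, c]%classic); last first.
    apply/seteqP; split => r /=; rewrite in_itv/= lee_fin; first by move=> [-> ->].
    by move=> /andP[].
  rewrite (_ : [set r : R | _ /\ r%:E < _] = `[0%R, c[%classic); last first.
    apply/seteqP; split => r /=; rewrite in_itv/= lte_fin; first by move=> [-> ->].
    by move=> /andP[].
  by rewrite integral_itv_bndo_bndc//; exact: measurable_decrearr.
Qed.

(** Markov's inequality at the level [t]; the added 1 keeps [t] positive when [h] has integral 0. *)
Lemma decrearr_lty s : (0 < s)%R -> decrearr mu h s < +oo.
Proof.
move=> s0; pose t := ((\int[mu]_x h x + 1) / s)%R.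
have J0 : (0 <= \int[mu]_x h x)%R by exact: Rintegral_ge0.
have t0 : (0 < t)%R by rewrite divr_gt0// ltr_wpDl.
apply: (@le_lt_trans _ _ t%:E); last exact: ltry.
rewrite decrearr_le.
have mt := measurable_gtset t mh; have too := L1_gtset_lty t0 h1.
rewrite -[leLHS]fineK ?ge0_fin_numE// lee_fin -Rint_indic//.
rewrite -(ler_pM2l t0) -RintZ; last exact: L1_indic.
apply: (@le_trans _ _ (\int[mu]_x h x)%R).
  apply: le_Rint => //; first exact/L1Z/L1_indic.
  by move=> x; rewrite indic_set; case: ltP => tx /=; rewrite ?mulr1 ?mulr0// ltW.
by rewrite /t divfK ?gt_eqF// lerDl.
Qed.

End decreasing_rearrangement.

(** * Duality between majorization and excess *)

Section majorization.
Context {d : measure_display} {T : measurableType d} {R : realType}.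
Variable mu : {sigma_finite_measure set T -> \bar R}.
Variables f g : T -> R.
Hypotheses (f1 : L1 mu f) (g1 : L1 mu g).
Hypotheses (f0 : forall x, (0 <= f x)%R) (g0 : forall x, (0 <= g x)%R).
Local Open Scope ereal_scope.

Let excess_dominated := (forall u, (0 < u)%R ->
  \int[mu]_x (Num.max (g x - u) 0)%:E <= \int[mu]_x (Num.max (f x - u) 0)%:E) /\
  \int[mu]_x (g x)%:E = \int[mu]_x (f x)%:E.

Lemma majorized_excess : majorized mu g f -> excess_dominated.
Proof.
move=> [maj eqint]; split; last by rewrite -!decrearr_fullE.
move=> u u0; have Doo := L1_gtset_lty u0 g1.
(* At this [s] the level [u] separates the rearrangement of [g], so the dual bound is an equality
   for [g] and an inequality for [f]; the finite term [u * s] then cancels. *)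
pose s := fine (distfun mu g u).
have sE : s%:E = distfun mu g u by rewrite fineK// ge0_fin_numE.
have s0 : (0 <= s)%R by exact: fine_ge0.
have sT : s%:E <= mu setT.
  rewrite sE; apply: le_measure; rewrite ?inE//.
  exact/measurable_gtset/L1_measurable/g1.
have := maj s s0 sT; rewrite !decrearr_itvE//.
rewrite (integral_decrearr_eq g1 s0 sT (ltW u0)); last 2 first.
- by move=> r r0 rs; rewrite ltW// decrearr_gt// -sE lte_fin.
- by move=> r sr rT; rewrite decrearr_le// -sE lee_fin.
move=> /le_trans/(_ (integral_decrearr_le f1 f0 s0 sT (ltW u0))).
by rewrite leeD2lE.
Qed.

Lemma excess_majorized : excess_dominated -> majorized mu g f.
Proof.
move=> [dom eqint]; split; last by rewrite !decrearr_fullE.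
have dom0 u : (0 <= u)%R ->
    \int[mu]_x (Num.max (g x - u) 0)%:E <= \int[mu]_x (Num.max (f x - u) 0)%:E.
  rewrite le_eqVlt => /predU1P[<-|]; last exact: dom.
  have E (k : T -> R) : (forall x, (0 <= k x)%R) ->
      \int[mu]_x (Num.max (k x - 0) 0)%:E = \int[mu]_x (k x)%:E.
    by move=> k0; apply: eq_integral => x _; rewrite subr0 max_l.
  by rewrite !E// eqint.
move=> s s0 sT; rewrite !decrearr_itvE//.
move: s0; rewrite le_eqVlt => /predU1P[<-|s0]; first by rewrite !set_itvE !integral_set0.
have [sltT|] := ltP s%:E (mu setT); last first.
  move=> Ts; have sTE : mu setT = s%:E by apply/eqP; rewrite eq_le Ts sT.
  have E : `[0%R, s[%classic = [set r : R | (0 <= r)%R /\ r%:E < mu setT].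
    apply/seteqP; split => r /=; rewrite in_itv/= sTE lte_fin.
      by move=> /andP[].
    by move=> [-> ->].
  by rewrite E !integral_decrearr_full// eqint.
(* Now the separating level comes from [f]: it is the value of its rearrangement at [s]. The
   endpoints were treated apart because this value can be [+oo] at 0 and is [-oo] at [mu setT]. *)
have u0' := decrearr_ge0 f0 sltT; have uoo := decrearr_lty f1 f0 s0.
have uE : decrearr mu f s = (fine (decrearr mu f s))%:E by rewrite fineK// ge0_fin_numE.
move: u0' uE; move: (fine _) => u u0 uE.
have {}u0 : (0 <= u)%R by rewrite -lee_fin -uE.
rewrite (integral_decrearr_eq f1 (ltW s0) sT u0); last 2 first.
- by move=> r r0 rs; rewrite -uE decrearr_homo// ltW.
- by move=> r sr _; rewrite -uE decrearr_homo.
apply: le_trans (integral_decrearr_le g1 g0 (ltW s0) sT u0) _.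
by rewrite leeD2l// dom0.
Qed.

End majorization.

(** * Completion of sub-kernels *)

Section kernel_completion.
Context {d : measure_display} {T : measurableType d} {R : realType}.
Variable mu : {sigma_finite_measure set T -> \bar R}.
Implicit Types a b : T -> R.

Lemma ge0_integral_scaler (p : R) (q : T -> R) : 0 <= p ->
  measurable_fun setT q -> (forall x, 0 <= q x) ->
  (\int[mu]_x (p * q x)%:E = p%:E * \int[mu]_x (q x)%:E)%E.
Proof.
move=> p0 mq q0; under eq_integral do rewrite EFinM.
rewrite ge0_integralZl//; first exact/measurable_EFinP.
by move=> x _; rewrite lee_fin.
Qed.

Lemma ge0_integral_addr (p q : T -> R) :
  measurable_fun setT p -> measurable_fun setT q ->
  (forall x, 0 <= p x) -> (forall x, 0 <= q x) ->
  (\int[mu]_x (p x + q x)%:E = \int[mu]_x (p x)%:E + \int[mu]_x (q x)%:E)%E.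
Proof.
move=> mp mq p0 q0; under eq_integral do rewrite EFinD.
rewrite ge0_integralD//.
- by move=> x _; rewrite lee_fin.
- exact/measurable_EFinP.
- by move=> x _; rewrite lee_fin.
- exact/measurable_EFinP.
Qed.

Lemma integral_mul_indic (q : T -> R) A : measurable A ->
  (\int[mu]_x (q x * \1_A x)%:E = \int[mu]_(x in A) (q x)%:E)%E.
Proof.
move=> mA; rewrite [RHS]integral_mkcond; apply: eq_integral => x _.
by rewrite patchE indicE; case: (x \in A); rewrite ?mulr1 ?mulr0.
Qed.

Lemma single_nneseries (u : nat -> R) m : (forall n, 0 <= u n) ->
  (forall n, n != m -> u n = 0) -> (\sum_(n <oo) (u n)%:E = (u m)%:E)%E.
Proof.
move=> u0 um; rewrite (@nneseriesD1 _ _ m)//; last by move=> n _; rewrite lee_fin.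
by rewrite eseries0 ?adde0// => n _ /= nm; rewrite um.
Qed.

(** The product of [a] and [b] divided by their common integral works. If that integral is 0, then
    [a] vanishes only almost everywhere, whence the form of the column identity. *)
Lemma finite_marginals a b : measurable_fun setT a -> measurable_fun setT b ->
  (forall x, 0 <= a x) -> (forall x, 0 <= b x) ->
  (\int[mu]_x (a x)%:E = \int[mu]_x (b x)%:E)%E -> L1 mu b ->
  exists K : T * T -> R, [/\ measurable_fun setT K, forall z, 0 <= K z,
    {ae mu, forall y, (\int[mu]_x (K (x, y))%:E = (a y)%:E)%E} &
    forall x, (\int[mu]_y (K (x, y))%:E <= (b x)%:E)%E].
Proof.
move=> ma mb a0 b0 ab b1.
pose c := \int[mu]_x b x.
have bc : (\int[mu]_x (b x)%:E = c%:E)%E by exact: L1_EFin.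
have c0 : 0 <= c by exact: Rintegral_ge0.
have c10 : 0 <= c^-1 by rewrite invr_ge0.
exists (fun z => a z.2 * (c^-1 * b z.1)); split.
- apply: measurable_funM; first exact: measurableT_comp ma measurable_snd.
  by apply: measurable_funM => //; exact: measurableT_comp mb measurable_fst.
- by move=> z; rewrite !mulr_ge0.
- have [cE|cN] := eqVneq c 0.
    have : ({ae mu, forall y, setT y -> (a y)%:E = (cst 0 y)})%E.
      apply/(ae_eq_integral_abs mu measurableT); first exact/measurable_EFinP.
      under eq_integral do rewrite /= ger0_norm//.
      by rewrite ab bc cE.
    apply: filterS => y /= /(_ I) ay; rewrite ay.
    by under eq_integral do rewrite cE invr0 mul0r mulr0; rewrite integral0.
  apply: aeW => y /=; rewrite !ge0_integral_scaler//.
  + by rewrite bc -!EFinM mulVf// mulr1.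
  + exact: measurable_funM.
  + by move=> x; rewrite mulr_ge0.
- move=> x /=; under eq_integral do rewrite mulrC.
  rewrite ge0_integral_scaler// ?mulr_ge0// ab bc -EFinM lee_fin.
  have [->|cN] := eqVneq c 0; first by rewrite mulr0.
  by rewrite mulrAC mulVf// mul1r.
Qed.

(* Each block of [a] along a countable partition into sets of finite measure is
   spread over a set on which [b] has so much mass that only a fraction
   [2^-(n+1)] of [b] is used. *)
Lemma infinite_marginals a b : measurable_fun setT a -> measurable_fun setT b ->
  (forall x, 0 <= a x <= 1) -> (forall x, 0 <= b x <= 1) ->
  (\int[mu]_x (b x)%:E = +oo)%E ->
  exists K : T * T -> R, [/\ measurable_fun setT K, forall z, 0 <= K z,
    forall y, (\int[mu]_x (K (x, y))%:E = (a y)%:E)%E &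
    forall x, (\int[mu]_y (K (x, y))%:E <= (b x)%:E)%E].
Proof.
move=> ma mb a01 b01 boo.
have a0 x : 0 <= a x by case/andP: (a01 x).
have b0 x : 0 <= b x by case/andP: (b01 x).
have /sigma_finiteP[F [FT ndF FP]] := sigma_finiteT mu.
have mF n := (FP n).1; have Foo n := (FP n).2.
pose A := seqDU F.
have mA n : measurable (A n) by exact: seqDU_measurable.
have Aoo n : (mu (A n) < +oo)%E.
  apply: le_lt_trans (Foo n); apply: le_measure; rewrite ?inE//.
  exact: subset_seqDU.
have AT y : exists n, A n y.
  have : setT y by []; rewrite FT seqDU_bigcup_eq => -[n _ Any]; by exists n.
have Adisj n m y : A n y -> A m y -> n = m.
  by move=> An Am; apply: (@trivIset_seqDU _ F) => //; exists y.
pose m n := fine (mu (A n)).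
have m0 n : 0 <= m n by exact: fine_ge0.
(* Adding 1 to [m n] keeps the divisor [c n] positive on blocks of measure zero. *)
have /choice[k kP] : forall n, exists k,
    (((2 ^ n.+1)%:R * (m n + 1))%:E <= \int[mu]_(x in F k) (b x)%:E)%E.
  move=> n; have : (\int[mu]_(x in F i) (b x)%:E @[i --> \oo] --> +oo)%E.
    rewrite -boo FT; apply: ge0_nondecreasing_set_cvg_integral => //.
    - by move=> i; apply/measurable_EFinP; exact: measurable_funTS.
    - by move=> i x _; rewrite lee_fin.
  move=> /cvgeyPge/(_ ((2 ^ n.+1)%:R * (m n + 1)))[N _ /(_ N (leqnn N)) ?].
  by exists N.
pose c n := fine (\int[mu]_(x in F (k n)) (b x)%:E)%E.
have cE n : (\int[mu]_(x in F (k n)) (b x)%:E = (c n)%:E)%E.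
  rewrite fineK// ge0_fin_numE; last by apply: integral_ge0 => x _; rewrite lee_fin.
  apply: le_lt_trans (Foo (k n)); rewrite -[leRHS]mul1e -integral_cst//.
  apply: ge0_le_integral => //.
  - by move=> x _; rewrite lee_fin.
  - by apply/measurable_EFinP; exact: measurable_funTS.
  - by move=> x _; rewrite lee_fin; case/andP: (b01 x).
have c_ge n : (2 ^ n.+1)%:R * (m n + 1) <= c n.
  by rewrite -lee_fin -cE.
have p0 n : 0 < (2 ^ n.+1)%:R :> R by rewrite ltr0n expn_gt0.
have c0 n : 0 < c n.
  by apply: lt_le_trans (c_ge n); rewrite mulr_gt0// ltr_wpDl.
have c10 n : 0 <= (c n)^-1 by rewrite invr_ge0 ltW.
pose al n y := a y * \1_(A n) y : R.
pose be n x := (c n)^-1 * (b x * \1_(F (k n)) x) : R.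
have i01 (B : set T) x : 0 <= (\1_B x : R) <= 1.
  by rewrite indicE; case: (_ \in _); rewrite ?lexx ?ler01.
have al0 n y : 0 <= al n y by rewrite mulr_ge0//; case/andP: (i01 (A n) y).
have bi0 n x : 0 <= b x * \1_(F (k n)) x.
  by rewrite mulr_ge0//; case/andP: (i01 (F (k n)) x).
have be0 n x : 0 <= be n x by rewrite mulr_ge0.
have mal n : measurable_fun setT (al n).
  by apply: measurable_funM => //; exact: measurable_indic.
have mbi n : measurable_fun setT (fun x => b x * \1_(F (k n)) x).
  by apply: measurable_funM => //; exact: measurable_indic.
have mbe n : measurable_fun setT (be n) by exact: measurable_funM.
have ibe n : (\int[mu]_x (be n x)%:E = 1)%E.
  rewrite ge0_integral_scaler// integral_mul_indic// cE -EFinM mulVf//.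
  by rewrite gt_eqF.
have ial n : (\int[mu]_y (al n y)%:E <= (m n)%:E)%E.
  rewrite integral_mul_indic// fineK ?ge0_fin_numE// -[leRHS]mul1e -integral_cst//.
  apply: ge0_le_integral => //.
  - by move=> x _; rewrite lee_fin.
  - by apply/measurable_EFinP; exact: measurable_funTS.
  - by move=> x _; rewrite lee_fin; case/andP: (a01 x).
have alE y j n : A j y -> n != j -> al n y = 0.
  move=> Aj nj; rewrite /al indicE memNset ?mulr0// => An.
  by move: nj; rewrite (Adisj _ _ _ An Aj) eqxx.
pose S z := (\sum_(n <oo) (al n z.2 * be n z.1)%:E)%E.
have SE x y j : A j y -> S (x, y) = (al j y * be j x)%:E.
  move=> Aj; apply: single_nneseries => [n|n nj]; first exact: mulr_ge0.
  by rewrite /= (alE _ _ _ Aj nj) mul0r.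
have KE x y : (fine (S (x, y)))%:E = S (x, y).
  by have [j Aj] := AT y; rewrite (SE _ _ _ Aj).
exists (fun z => fine (S z)); split.
- apply: measurableT_comp; first exact: fine_measurable.
  apply: (@ge0_emeasurable_sum _ _ _ _ (fun n z => (al n z.2 * be n z.1)%:E) xpredT).
  + by move=> n z _ _; rewrite lee_fin mulr_ge0.
  + move=> n _; apply/measurable_EFinP; apply: measurable_funM.
      exact: measurableT_comp (mal n) measurable_snd.
    exact: measurableT_comp (mbe n) measurable_fst.
- move=> z; rewrite fine_ge0//; apply: nneseries_ge0 => n _ _.
  by rewrite lee_fin mulr_ge0.
- move=> y; have [j Aj] := AT y.
  under eq_integral do rewrite KE (SE _ _ _ Aj).
  rewrite ge0_integral_scaler// ibe mule1 /al indicE mem_set// mulr1//.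
- move=> x; under eq_integral do rewrite KE /S.
  rewrite integral_nneseries//; last 2 first.
  + move=> n; apply/measurable_EFinP; apply: measurable_funM; [exact: mal|exact: (measurable_cst (be n x))].
  + by move=> n y _; rewrite lee_fin mulr_ge0.
  apply: le_trans (epsilon_trick0 xpredT (b0 x)); apply: lee_nneseries => n.
    by move=> _ _; apply: integral_ge0 => y _; rewrite lee_fin mulr_ge0.
  move=> _ /=; under eq_integral do rewrite mulrC.
  rewrite ge0_integral_scaler//.
  apply: (le_trans (lee_wpmul2l _ (ial n))); first by rewrite lee_fin.
  rewrite -EFinM lee_fin /be mulrAC mulrC.
  have /andP[? i1] := i01 (F (k n)) x.
  apply: ler_pM => //; first by rewrite mulr_ge0.
    by rewrite ler_piMr.
  rewrite ler_pdivrMl// ler_pdivlMr//; apply: le_trans (c_ge n).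
  by rewrite mulrC ler_wpM2l ?(ltW (p0 _))// lerDl.
Qed.

(** The column defect [a] has to be filled exactly, the row defect [b] is only a ceiling. Tonelli
    gives [K] the same total by rows and by columns, and since this total is finite it cancels
    against [mu setT] even when that is infinite; so the defects have equal integrals. *)
Lemma kernel_completion (K : T * T -> R) : measurable_fun setT K ->
  (forall z, 0 <= K z) ->
  (forall y, (\int[mu]_x (K (x, y))%:E <= 1)%E) ->
  (forall x, (\int[mu]_y (K (x, y))%:E <= 1)%E) ->
  (\int[mu]_x \int[mu]_y (K (x, y))%:E < +oo)%E ->
  exists K', sds_kernel mu K' /\ forall z, K z <= K' z.
Proof.
move=> mK K0 Kcol Krow Koo.
pose col y := fine (\int[mu]_x (K (x, y))%:E)%E.
pose row x := fine (\int[mu]_y (K (x, y))%:E)%E.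
have colE y : (\int[mu]_x (K (x, y))%:E = (col y)%:E)%E.
  rewrite fineK// ge0_fin_numE; first exact: le_lt_trans (Kcol y) (ltry _).
  by apply: integral_ge0 => x _; rewrite lee_fin.
have rowE x : (\int[mu]_y (K (x, y))%:E = (row x)%:E)%E.
  rewrite fineK// ge0_fin_numE; first exact: le_lt_trans (Krow x) (ltry _).
  by apply: integral_ge0 => y _; rewrite lee_fin.
have col01 y : 0 <= col y <= 1.
  rewrite -lee_fin -colE; apply/andP; split.
    by rewrite fine_ge0// integral_ge0// => x _; rewrite lee_fin.
  exact: Kcol.
have row01 x : 0 <= row x <= 1.
  rewrite -lee_fin -rowE; apply/andP; split.
    by rewrite fine_ge0// integral_ge0// => y _; rewrite lee_fin.
  exact: Krow.
have mKE : measurable_fun setT (fun z => (K z)%:E) by exact/measurable_EFinP.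
have KE0 z : (0 <= (K z)%:E)%E by rewrite lee_fin.
have mcol : measurable_fun setT col.
  apply: measurableT_comp; first exact: fine_measurable.
  exact: (measurable_fun_fubini_tonelli_G _ mKE KE0).
have mrow : measurable_fun setT row.
  apply: measurableT_comp; first exact: fine_measurable.
  exact: (measurable_fun_fubini_tonelli_F _ mKE KE0).
pose a y := 1 - col y; pose b x := 1 - row x.
have a01 y : 0 <= a y <= 1 by have := col01 y; rewrite /a; lra.
have b01 x : 0 <= b x <= 1 by have := row01 x; rewrite /b; lra.
have ma : measurable_fun setT a by exact: measurable_funB.
have mb : measurable_fun setT b by exact: measurable_funB.
have total (q : T -> R) : measurable_fun setT q -> (forall x, 0 <= q x <= 1) ->
    (\int[mu]_x (1 - q x)%:E + \int[mu]_x (q x)%:E = mu setT)%E.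
  move=> mq q01; rewrite -ge0_integralD//.
  - rewrite -[RHS]mul1e -integral_cst//; apply: eq_integral => x _ /=.
    by rewrite -EFinD subrK.
  - by move=> x _; rewrite lee_fin subr_ge0; case/andP: (q01 x).
  - by apply/measurable_EFinP; exact: measurable_funB.
  - by move=> x _; rewrite lee_fin; case/andP: (q01 x).
  - exact/measurable_EFinP.
have Irow : (\int[mu]_x (row x)%:E = \int[mu]_x \int[mu]_y (K (x, y))%:E)%E.
  by apply: eq_integral => x _; rewrite rowE.
have Icol : (\int[mu]_x (col x)%:E = \int[mu]_x (row x)%:E)%E.
  rewrite Irow (fubini_tonelli (fun z => (K z)%:E))//.
  by apply: eq_integral => x _; rewrite /= colE.
have rfin : (\int[mu]_x (row x)%:E \is a fin_num)%E.
  rewrite ge0_fin_numE; first by rewrite Irow.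
  apply: integral_ge0 => x _; rewrite lee_fin.
  by case/andP: (row01 x).
have abE : (\int[mu]_x (a x)%:E = \int[mu]_x (b x)%:E)%E.
  rewrite -[LHS](addeK _ rfin) -[RHS](addeK _ rfin); congr (_ - _)%E.
  rewrite -{1}Icol; transitivity (mu setT); first exact: total mcol col01.
  by apply/esym; exact: total mrow row01.
have b0 x : 0 <= b x by case/andP: (b01 x).
have a0 x : 0 <= a x by case/andP: (a01 x).
have [M [mM M0 Mcol Mrow]] : exists M : T * T -> R,
    [/\ measurable_fun setT M, forall z, 0 <= M z,
    {ae mu, forall y, (\int[mu]_x (M (x, y))%:E = (a y)%:E)%E} &
    forall x, (\int[mu]_y (M (x, y))%:E <= (b x)%:E)%E].
  have [boo|] := eqVneq (\int[mu]_x (b x)%:E)%E +oo%E.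
    have [M [mM M0 Mcol Mrow]] := infinite_marginals ma mb a01 b01 boo.
    by exists M; split => //; exact: aeW.
  rewrite -ltey => boo; apply: finite_marginals => //.
  exact: L1_ge0P.
exists (fun z => K z + M z); split; last by move=> z; rewrite lerDl.
split.
- exact: measurable_funD.
- by move=> z; rewrite addr_ge0.
- apply: filterS Mcol => y My.
  rewrite ge0_integral_addr; [|exact: measurable_kernel_r..|by []|by []].
  by rewrite My colE -EFinD /a addrC subrK.
- apply: aeW => x; rewrite ge0_integral_addr; [|exact: measurable_kernel_l..|by []|by []].
  rewrite rowE; apply: le_trans (leeD2l _ (Mrow x)) _; rewrite -EFinD lee_fin /b.
  by rewrite addrC subrK.
Qed.

End kernel_completion.

(** * Kernels for step functions *)

Section shadow_family.
Context {d : measure_display} {T : measurableType d} {R : realType}.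
Variable mu : {measure set T -> \bar R}.

Lemma Rint_sum n (h : nat -> T -> R) : (forall i, (i < n)%N -> L1 mu (h i)) ->
  L1 mu (fun x => \sum_(i < n) h i x) /\
  \int[mu]_x (\sum_(i < n) h i x) = \sum_(i < n) \int[mu]_x h i x.
Proof.
elim: n => [|n IH] hL1.
  split.
    rewrite (_ : (fun x => _) = cst 0); first exact: integrable0.
    by apply/funext => x; rewrite big_ord0.
  rewrite big_ord0 (@eq_Rint _ _ _ mu _ (cst 0)); last by move=> x; rewrite big_ord0.
  by rewrite Rintegral_cst// mul0r.
have [|i1 i2] := IH; first by move=> i ilt; apply: hL1; exact: ltnW.
have E x : \sum_(i < n.+1) h i x = \sum_(i < n) h i x + h n x.
  by rewrite big_ord_recr.
split.
  rewrite (_ : (fun x => _) = (fun x => \sum_(i < n) h i x + h n x)).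
    by apply: L1D => //; exact: hL1.
  exact/funext.
rewrite (eq_Rint mu E) RintD//; last exact: hL1.
by rewrite i2 big_ord_recr.
Qed.

Variable f : T -> R.
Hypothesis f1 : L1 mu f.
Hypothesis f0 : forall x, 0 <= f x.

(** Shadows are removed from the highest level down: the excess [G] of the levels still to come then
    vanishes above the current one, as [shadow] requires. *)
Lemma shadow_family n (w b : nat -> R) (rho : T -> R) :
  measurable_fun setT rho -> (forall x, 0 <= rho x <= 1) ->
  (forall i, 0 <= w i) -> (forall i, (i < n)%N -> 0 < b i) ->
  (forall i, b i.+1 <= b i) ->
  (forall u, 0 <= u -> \sum_(i < n) w i * Num.max (b i - u) 0 <=
     \int[mu]_x (rho x * Num.max (f x - u) 0)) ->
  exists p : nat -> T -> R, [/\ forall i, measurable_fun setT (p i),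
    forall i x, 0 <= p i x, forall x, \sum_(i < n) p i x <= rho x &
    forall i, (i < n)%N -> [/\ L1 mu (p i), \int[mu]_x p i x <= w i &
      \int[mu]_x (p i x * f x) = w i * b i]].
Proof.
elim: n w b rho => [|n IH] w b rho mrho rho01 w0 b0 bd dom.
  exists (fun _ _ => 0); split => // x.
  by rewrite big_ord0; case/andP: (rho01 x).
have bdm i : b i.+1 <= b 0%N.
  by elim: i => [|i IHi]; [exact: bd|exact: le_trans (bd _) IHi].
pose G u := \sum_(i < n) w i.+1 * Num.max (b i.+1 - u) 0.
have max0 (y : R) : 0 <= Num.max y 0 by rewrite le_max lexx orbT.
have [||||p [mp p_rho pL1 pw [pf rest]]] :=
    @shadow _ _ _ mu f rho f1 f0 mrho rho01 (w 0%N) (b 0%N) G (w0 _) (b0 0%N isT).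
- move=> u u0 ub; apply: le_trans (dom u u0).
  by rewrite big_ord_recl/= max_l ?subr_ge0.
- by move=> u; apply: sumr_ge0 => i _; rewrite mulr_ge0.
- move=> u bu; apply: big1 => i _.
  by rewrite max_r ?mulr0// subr_le0 (le_trans (bdm i)).
(* The chord condition holds term by term, each positive part being convex in the level and zero at
   [b 0]. *)
- move=> a u au ub; rewrite !mulr_sumr; apply: ler_sum => i _.
  rewrite mulrCA [leRHS]mulrCA ler_wpM2l//.
  have := bdm i; move: (b i.+1) (b 0%N) ub => c B ub cB.
  by case: (leP (c - u)) => h1; case: (leP (c - a)) => h2; nra.
have [||||||q [mq q0 qrho qP]] := IH (fun i => w i.+1) (fun i => b i.+1)
    (fun x => rho x - p x).
- exact: measurable_funB.
- by move=> x; have := p_rho x; have := rho01 x; lra.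
- by [].
- by move=> i ilt; exact: b0.
- by [].
- exact: rest.
exists (fun i => if i is j.+1 then q j else p); split.
- by case.
- by case => // x; case/andP: (p_rho x).
- by move=> x; rewrite big_ord_recl/=; have := qrho x; lra.
- by case => [_|i ilt]; [split|exact: qP].
Qed.

End shadow_family.

Section disjoint_sums.
Context {T : Type} {R : realType}.
Variables (N : nat) (B : nat -> set T).
Hypothesis disj : forall i j x, (i < N)%N -> (j < N)%N -> B i x -> B j x -> i = j.

Lemma disjoint_sum_in i x (c : nat -> R) : (i < N)%N -> B i x ->
  \sum_(j < N) c j * \1_(B j) x = c i.
Proof.
move=> iN Bi; rewrite (bigD1 (Ordinal iN))//= indicE mem_set// mulr1.
rewrite big1 ?addr0// => j ji; rewrite indicE memNset ?mulr0// => Bj.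
by move/negP: ji; apply; apply/eqP/val_inj => /=; exact: disj Bj Bi.
Qed.

Lemma disjoint_sum_out x (c : nat -> R) : (forall i, (i < N)%N -> ~ B i x) ->
  \sum_(j < N) c j * \1_(B j) x = 0.
Proof.
by move=> Bn; apply: big1 => j _; rewrite indicE memNset ?mulr0//; exact: Bn.
Qed.

Lemma disjoint_sumP x : (exists2 i, (i < N)%N & B i x) \/
  (forall i, (i < N)%N -> ~ B i x).
Proof.
have [[i [iN Bi]]|/forallNP H] := pselect (exists i, (i < N)%N /\ B i x).
  by left; exists i.
by right => i iN Bi; apply: (H i).
Qed.

Lemma disjoint_sum_comp (phi : R -> R) x (c : nat -> R) : phi 0 = 0 ->
  phi (\sum_(j < N) c j * \1_(B j) x) = \sum_(j < N) phi (c j) * \1_(B j) x.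
Proof.
move=> phi0; have [[i iN Bi]|Bn] := disjoint_sumP x.
  by rewrite (disjoint_sum_in c iN Bi) (disjoint_sum_in (phi \o c) iN Bi).
by rewrite (disjoint_sum_out c Bn) phi0 (disjoint_sum_out (phi \o c) Bn).
Qed.

End disjoint_sums.

Section simple_kernel.
Context {d : measure_display} {T : measurableType d} {R : realType}.
Variable mu : {sigma_finite_measure set T -> \bar R}.
Variable f : T -> R.
Hypothesis f1 : L1 mu f.
Hypothesis f0 : forall x, 0 <= f x.

(* The factor [(w i)^-1 * w i] vanishes on the blocks of measure zero, where
   the kernel is zero. *)
Lemma simple_kernel N (b : nat -> R) (B : nat -> set T) (w := fun i => fine (mu (B i))) :
  (forall i, measurable (B i)) -> (forall i, (i < N)%N -> (mu (B i) < +oo)%E) ->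
  (forall i j x, (i < N)%N -> (j < N)%N -> B i x -> B j x -> i = j) ->
  (forall i, (i < N)%N -> 0 < b i) -> (forall i, b i.+1 <= b i) ->
  (forall u, 0 <= u -> \sum_(i < N) w i * Num.max (b i - u) 0 <=
     \int[mu]_x Num.max (f x - u) 0) ->
  exists K, sds_kernel mu K /\ {ae mu, forall x,
    \sum_(i < N) ((w i)^-1 * w i * b i) * \1_(B i) x <= int_op mu K f x}.
Proof.
move=> mB Boo disj b0 bd dom.
have w0 i : 0 <= w i by exact: fine_ge0.
have w10 i : 0 <= (w i)^-1 by rewrite invr_ge0.
have ww i : 0 <= (w i)^-1 * w i <= 1.
  have [->|wN] := eqVneq (w i) 0; first by rewrite mulr0 lexx ler01.
  by rewrite mulVf// lexx ler01.
have i0 i x : 0 <= (\1_(B i) x : R) by rewrite indicE.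
have dom1 u : 0 <= u -> \sum_(i < N) w i * Num.max (b i - u) 0 <=
    \int[mu]_x (cst 1 x * Num.max (f x - u) 0).
  move=> u0; apply: le_trans (dom u u0) _.
  rewrite (@eq_Rint _ _ _ mu _ (fun x => cst 1 x * Num.max (f x - u) 0))// => x.
  by rewrite mul1r.
have c01 (x : T) : 0 <= (cst 1 x : R) <= 1 by rewrite ler01 lexx.
have [p [mp p0 psum pP]] := shadow_family f1 f0 (measurable_cst _) c01 w0 b0 bd dom1.
pose K z := \sum_(i < N) ((w i)^-1 * \1_(B i) z.1) * p i z.2.
have mK : measurable_fun setT K.
  apply: measurable_sum => i; apply: measurable_funM.
    apply: measurable_funM => //.
    by apply: measurableT_comp measurable_fst; exact: measurable_indic.
  exact: measurableT_comp (mp i) measurable_snd.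
have K0 z : 0 <= K z by apply: sumr_ge0 => i _; rewrite !mulr_ge0.
have sum1 x : \sum_(i < N) \1_(B i) x <= 1 :> R.
  under eq_bigr do rewrite -[\1_ _ _]mul1r.
  have [[i iN Bi]|Bn] := disjoint_sumP N B x.
    by rewrite (disjoint_sum_in disj (cst 1) iN Bi).
  by rewrite (disjoint_sum_out (cst 1) Bn) ler01.
have iB i : (i < N)%N -> L1 mu (\1_(B i) : T -> R).
  by move=> iN; apply: L1_indic => //; exact: Boo.
have Kcol y : (\int[mu]_x (K (x, y))%:E <= 1)%E.
  have [|i1 i2] := @Rint_sum _ _ _ mu N (fun i x => ((w i)^-1 * p i y) * \1_(B i) x).
    by move=> i iN; exact/L1Z/iB.
  rewrite (eq_integral (fun x => (\sum_(i < N) ((w i)^-1 * p i y) * \1_(B i) x)%:E)); last first.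
    by move=> x _; congr EFin; apply: eq_bigr => i _; rewrite /= mulrAC.
  rewrite L1_EFin// i2 lee_fin; apply: le_trans (psum y); apply: ler_sum => i _.
  rewrite RintZ; last exact: iB.
  rewrite Rint_indic// -/(w i) mulrAC ler_piMl//; by case/andP: (ww i).
have Kint x (h : T -> R) : (forall i, (i < N)%N -> L1 mu (fun y => p i y * h y)) ->
    L1 mu (fun y => K (x, y) * h y) /\ \int[mu]_y (K (x, y) * h y) =
    \sum_(i < N) ((w i)^-1 * \int[mu]_y (p i y * h y)) * \1_(B i) x.
  move=> ph; have [|i1 i2] := @Rint_sum _ _ _ mu N
      (fun i y => ((w i)^-1 * \1_(B i) x) * (p i y * h y)).
    by move=> i iN; exact/L1Z/ph.
  have E : (fun y => K (x, y) * h y) = (fun y => \sum_(i < N)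
      ((w i)^-1 * \1_(B i) x) * (p i y * h y)).
    by apply/funext => y; rewrite mulr_suml; apply: eq_bigr => i _; rewrite mulrA.
  rewrite E; split => //; rewrite i2; apply: eq_bigr => i _.
  by rewrite RintZ; [rewrite mulrAC|exact: ph].
have Krow x : (\int[mu]_y (K (x, y))%:E <= (\sum_(i < N) \1_(B i) x)%:E)%E.
  have [|i1 i2] := Kint x (cst 1).
    move=> i iN; have [pi1 _ _] := pP i iN.
    by rewrite (_ : (fun y => _) = p i)//; apply/funext => y; rewrite mulr1.
  rewrite (eq_integral (fun y => (K (x, y) * cst 1 y)%:E)); last first.
    by move=> y _; rewrite mulr1.
  rewrite L1_EFin// i2 lee_fin; apply: ler_sum => i _.
  rewrite ler_piMl//; have [_ piw _] := pP i (ltn_ord i).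
  apply: le_trans (_ : (w i)^-1 * w i <= _); last by case/andP: (ww i).
  rewrite ler_wpM2l// (@eq_Rint _ _ _ mu _ (p i))// => y.
  by rewrite mulr1.
have Krow1 x : (\int[mu]_y (K (x, y))%:E <= 1)%E.
  by apply: le_trans (Krow x) _; rewrite lee_fin.
have Koo : (\int[mu]_x \int[mu]_y (K (x, y))%:E < +oo)%E.
  have [i1 i2] := @Rint_sum _ _ _ mu N (fun i x => \1_(B i) x) iB.
  apply: (@le_lt_trans _ _ (\int[mu]_x (\sum_(i < N) \1_(B i) x)%:E)%E); last first.
    by rewrite L1_EFin// ltry.
  apply: ge0_le_integral => //.
  - by move=> x _; apply: integral_ge0 => y _; rewrite lee_fin.
  - apply: (measurable_fun_fubini_tonelli_F (fun z => (K z)%:E)) => //.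
    exact/measurable_EFinP.
  - exact: measurable_int i1.
(* From here on the image of [f] is known only from below; the preserved integral will control the
   surplus. *)
have [K' [sK' KK']] := kernel_completion mK K0 Kcol Krow1 Koo.
exists K'; split => //.
have [mK' K'0 K'col _] := sK'.
have K'1 : {ae mu, forall y, (\int[mu]_x (K' (x, y))%:E <= 1)%E}.
  by apply: filterS K'col => y ->.
apply: filterS (int_op_ae mK' K'0 K'1 f1) => x ix.
have [|j1 j2] := Kint x f.
  move=> i iN; have [pi1 _ _] := pP i iN.
  apply: (L1_dominated _ _ f1).
    by apply: measurable_funM => //; exact: L1_measurable f1.
  move=> y; rewrite ger0_norm ?mulr_ge0// ler_piMl//.
  apply: le_trans (psum y); rewrite (bigD1 (Ordinal iN))//= lerDl.
  exact: sumr_ge0.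
rewrite (_ : \sum_(i < N) _ = \int[mu]_y (K (x, y) * f y)); last first.
  rewrite j2; apply: eq_bigr => i _; have [_ _ ->] := pP i (ltn_ord i).
  by rewrite mulrA.
by apply: le_Rint => // y; rewrite ler_wpM2r.
Qed.

End simple_kernel.

(** * Approximation by level functions *)

Section level_approximation.
Context {d : measure_display} {T : measurableType d} {R : realType}.
Variable mu : {sigma_finite_measure set T -> \bar R}.
Variable g : T -> R.
Hypothesis g1 : L1 mu g.
Hypothesis g0 : forall x, 0 <= g x.

Let mg : measurable_fun setT g := L1_measurable g1.

Definition level_num n := (n.+1 * n.+1)%N.
(** Numbered downwards from [n.+1], in the order in which shadows are removed. Truncated subtraction
    makes the sequence 0 from [level_num n] on, so it is nonincreasing without a bound on [i]. *)
Definition level n i : R := (level_num n - i)%:R * n.+1%:R^-1.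
Definition level_set n i : set T :=
  [set x | level n i <= g x < level n i + n.+1%:R^-1].
Definition level_fun n x : R :=
  \sum_(i < level_num n) level n i * \1_(level_set n i) x.

Let dl0 n : 0 < n.+1%:R^-1 :> R. Proof. by rewrite invr_gt0. Qed.

Lemma level_gt0 n i : (i < level_num n)%N -> 0 < level n i.
Proof. by move=> iN; rewrite mulr_gt0// ltr0n subn_gt0. Qed.

Lemma level_homo n i : level n i.+1 <= level n i.
Proof. by rewrite ler_wpM2r ?(ltW (dl0 _))// ler_nat leq_sub2l. Qed.

Lemma measurable_level_set n i : measurable (level_set n i).
Proof.
rewrite (_ : level_set n i = [set x | level n i <= g x] `\`
    [set x | level n i + n.+1%:R^-1 <= g x]).
  by apply: measurableD; exact: measurable_geset.
apply/seteqP; split => x; rewrite /level_set /=.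
  by move=> /andP[-> h]; split => //; apply/negP; rewrite -ltNge.
by move=> [-> /negP]; rewrite -ltNge => ->.
Qed.

Lemma level_set_disjoint n i j x : (i < level_num n)%N -> (j < level_num n)%N ->
  level_set n i x -> level_set n j x -> i = j.
Proof.
move=> iN jN /andP[i1 i2] /andP[j1 j2].
have lt k l : level n k < level n l + n.+1%:R^-1 ->
    (level_num n - k <= level_num n - l)%N.
  have -> : level n l + n.+1%:R^-1 = (level_num n - l).+1%:R * n.+1%:R^-1.
    by rewrite /level -[(_ - _).+1%:R]natr1 mulrDl mul1r.
  by rewrite ltr_pM2r// ltr_nat ltnS.
have h1 := lt _ _ (le_lt_trans i1 j2); have h2 := lt _ _ (le_lt_trans j1 i2).
have /eqP : (level_num n - i)%N = (level_num n - j)%N.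
  by apply/eqP; rewrite eqn_leq h1 h2.
by rewrite eqn_sub2lE; [move/eqP|exact: ltnW|exact: ltnW].
Qed.

Lemma level_set_lty n i : (i < level_num n)%N -> (mu (level_set n i) < +oo)%E.
Proof.
move=> iN; have l0 := level_gt0 iN.
have l2 : 0 < level n i / 2 by rewrite divr_gt0.
apply: le_lt_trans (L1_gtset_lty l2 g1); apply: le_measure; rewrite ?inE.
- exact: measurable_level_set.
- exact: measurable_gtset.
- by move=> x /= /andP[+ _]; apply: lt_le_trans; lra.
Qed.

Lemma level_fun_ge0 n x : 0 <= level_fun n x.
Proof.
apply: sumr_ge0 => i _; rewrite mulr_ge0 ?indicE//.
exact: mulr_ge0.
Qed.

Lemma level_fun_le n x : level_fun n x <= g x.
Proof.
rewrite /level_fun.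
have [[i iN Bi]|Bn] := disjoint_sumP (level_num n) (level_set n) x.
  rewrite (disjoint_sum_in (@level_set_disjoint n) _ iN Bi).
  by case/andP: Bi.
by rewrite (disjoint_sum_out _ Bn).
Qed.

Lemma level_fun_ge n x : g x < n.+1%:R -> g x - n.+1%:R^-1 <= level_fun n x.
Proof.
move=> gn; have n0 : 0 < n.+1%:R :> R by [].
pose k := Num.truncn (g x * n.+1%:R).
have /andP[k3 k4] : k%:R <= g x * n.+1%:R < k.+1%:R.
  by apply: truncn_itv; rewrite mulr_ge0.
have k1 : k%:R * n.+1%:R^-1 <= g x by rewrite ler_pdivrMr.
have k2 : g x < k%:R * n.+1%:R^-1 + n.+1%:R^-1.
  by rewrite -[X in _ + X]mul1r -mulrDl natr1 ltr_pdivlMr.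
(* Values below the lowest positive level belong to no block, and there 0 is already close enough to
   [g x]. *)
have [k0|k0] := posnP k.
  move: k2; rewrite k0 mul0r add0r => k2.
  by apply: le_trans (level_fun_ge0 n x); rewrite subr_le0 ltW.
have kN : (k <= level_num n)%N.
  rewrite -ltnS -(ltr_nat R).
  apply: (@le_lt_trans _ _ (g x * n.+1%:R)); first exact: k3.
  by rewrite -[(level_num n).+1%:R]natr1 natrM ltr_wpDr// ltr_pM2r.
have iN : (level_num n - k < level_num n)%N.
  by rewrite ltn_subrL k0 /level_num muln_gt0.
have lE : level n (level_num n - k) = k%:R * n.+1%:R^-1 by rewrite /level subKn.
have Bi : level_set n (level_num n - k)%N x by rewrite /level_set/= lE k1 k2.
rewrite /level_fun (disjoint_sum_in (@level_set_disjoint n) _ iN Bi) lE.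
by rewrite lerBlDr ltW.
Qed.

Lemma measurable_level_fun n : measurable_fun setT (level_fun n).
Proof.
apply: measurable_sum => i; apply: measurable_funM => //.
exact/measurable_indic/measurable_level_set.
Qed.

Lemma level_fun_L1 n : L1 mu (level_fun n).
Proof.
apply: (L1_dominated _ _ g1); first exact: measurable_level_fun.
by move=> x; rewrite ger0_norm ?level_fun_ge0 ?level_fun_le.
Qed.

Lemma level_fun_cvg x : level_fun n x @[n --> \oo] --> g x.
Proof.
apply: (@squeeze_cvgr _ _ _ _ (fun n => g x - n.+1%:R^-1) (cst (g x))).
- near=> n; rewrite level_fun_le andbT level_fun_ge//.
  near: n; have := nbhs_infty_ger (g x); apply: filterS => n xn.
  by apply: le_lt_trans xn _; rewrite ltr_nat.
- rewrite -[X in _ --> X]subr0; apply: cvgB; first exact: cvg_cst.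
  exact: cvg_harmonic.
- exact: cvg_cst.
Unshelve. all: by end_near. Qed.

Lemma level_fun_cvg_integral :
  (\int[mu]_x (level_fun n x)%:E)%E @[n --> \oo] --> (\int[mu]_x (g x)%:E)%E.
Proof.
apply: (@dominated_cvg _ _ _ mu setT measurableT _ _ (fun x => (g x)%:E)) => //.
- by move=> n; apply/measurable_EFinP; exact: measurable_level_fun.
- by move=> x _; apply: cvg_EFin; [exact: nearW|exact: level_fun_cvg].
- by move=> n x _; rewrite /= lee_fin ger0_norm ?level_fun_ge0 ?level_fun_le.
Qed.

Lemma level_fun_integral n (phi : R -> R) : phi 0 = 0 ->
  \int[mu]_x phi (level_fun n x) =
  \sum_(i < level_num n) fine (mu (level_set n i)) * phi (level n i).
Proof.
move=> phi0.
have iB i : (i < level_num n)%N -> L1 mu (\1_(level_set n i) : T -> R).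
  move=> iN; apply: L1_indic; first exact: measurable_level_set.
  exact: level_set_lty.
have [|i1 i2] := @Rint_sum _ _ _ mu (level_num n)
    (fun i x => phi (level n i) * \1_(level_set n i) x).
  by move=> i iN; exact/L1Z/iB.
rewrite (@eq_Rint _ _ _ mu _ (fun x => \sum_(i < level_num n)
    phi (level n i) * \1_(level_set n i) x)).
  rewrite i2; apply: eq_bigr => i _; rewrite RintZ; last exact: iB.
  by rewrite Rint_indic 1?mulrC//; exact: measurable_level_set.
by move=> x; rewrite /level_fun (disjoint_sum_comp (@level_set_disjoint n)).
Qed.

Variable f : T -> R.
Hypothesis f1 : L1 mu f.
Hypothesis f0 : forall x, 0 <= f x.
Hypothesis dom : forall u, 0 < u ->
  \int[mu]_x Num.max (g x - u) 0 <= \int[mu]_x Num.max (f x - u) 0.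
Hypothesis eqint : \int[mu]_x g x = \int[mu]_x f x.

Let dom0 u : 0 <= u ->
  \int[mu]_x Num.max (g x - u) 0 <= \int[mu]_x Num.max (f x - u) 0.
Proof.
rewrite le_eqVlt => /predU1P[<-|]; last exact: dom.
rewrite (@eq_Rint _ _ _ mu _ g); last by move=> x; rewrite subr0 max_l.
rewrite (@eq_Rint _ _ _ mu (fun x => Num.max (f x - 0) 0) f) ?eqint//.
by move=> x; rewrite subr0 max_l.
Qed.

(** The image of [f] and [g] both lie above the same step function almost everywhere and have equal
    integrals, so each exceeds it by the same amount in integral; the triangle inequality gives the
    factor 2. *)
Lemma level_kernel n : exists K, sds_kernel mu K /\
  (\int[mu]_x `|int_op mu K f x - g x|%:E <=
   (2 * (\int[mu]_x g x - \int[mu]_x level_fun n x))%:E)%E.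
Proof.
have [|||||u u0|K [sK Kae]] := @simple_kernel _ _ _ mu f f1 f0 (level_num n) (level n) (level_set n).
- by move=> i; exact: measurable_level_set.
- by move=> i; exact: level_set_lty.
- exact: level_set_disjoint.
- by move=> i; exact: level_gt0.
- exact: level_homo.
- rewrite -(@level_fun_integral n (fun y => Num.max (y - u) 0)); last first.
    by rewrite sub0r max_r// oppr_le0.
  apply: le_trans (dom0 u0); apply: le_Rint.
  + exact/L1_pospart/level_fun_L1.
  + exact: L1_pospart.
  + move=> x; have := level_fun_le n x.
    by rewrite ge_max !le_max lexx orbT andbT lerD2r => ->.
exists K; split => //.
have sS := sds_kernel_op sK; have [SL1 _ _ _ [Sint _]] := sS.
have iK := SL1 _ f1.
have JK : \int[mu]_x int_op mu K f x = \int[mu]_x f x by rewrite /Rintegral Sint.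
pose w i := fine (mu (level_set n i)).
(* This differs from [level_fun n] only on blocks of measure zero, hence has the same integral. *)
pose l x := \sum_(i < level_num n) ((w i)^-1 * w i * level n i) * \1_(level_set n i) x.
have wwE i : w i * ((w i)^-1 * w i) = w i.
  have [->|wN] := eqVneq (w i) 0; first by rewrite mul0r.
  by rewrite mulVf// mulr1.
have iB i : (i < level_num n)%N -> L1 mu (\1_(level_set n i) : T -> R).
  move=> iN; apply: L1_indic; first exact: measurable_level_set.
  exact: level_set_lty.
have [|l1 l2] := @Rint_sum _ _ _ mu (level_num n)
    (fun i x => ((w i)^-1 * w i * level n i) * \1_(level_set n i) x).
  by move=> i iN; exact/L1Z/iB.
have Jl : \int[mu]_x l x = \int[mu]_x level_fun n x.
  rewrite (@level_fun_integral n id)// l2; apply: eq_bigr => i _.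
  rewrite RintZ; last exact: iB.
  rewrite Rint_indic; last exact: measurable_level_set.
  by rewrite -/(w i) mulrC mulrA wwE.
have lg x : l x <= g x.
  apply: le_trans (level_fun_le n x); apply: ler_sum => i _.
  rewrite ler_wpM2r ?indicE// ler_piMl//; first exact: ltW (level_gt0 _).
  have [->|wN] := eqVneq (w i) 0; first by rewrite mulr0 ler01.
  by rewrite mulVf.
have iKg : L1 mu (fun x => `|int_op mu K f x - g x|) by apply/L1_norm/L1B.
rewrite L1_EFin// lee_fin.
have iKl := L1B iK l1; have igl := L1B g1 l1.
apply: (@le_trans _ _ (\int[mu]_x ((int_op mu K f x - l x) + (g x - l x)))).
  apply: le_Rint_ae => //; first exact: L1D.
  apply: filterS Kae => x lx.
  rewrite (_ : int_op mu K f x - g x = (int_op mu K f x - l x) - (g x - l x)); last by ring.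
  apply: le_trans (ler_normB _ _) _.
  by rewrite !ger0_norm ?subr_ge0.
by rewrite RintD// !RintB// JK Jl -eqint; lra.
Qed.

Lemma excess_kernels : exists K : nat -> T * T -> R,
  (forall n, sds_kernel mu (K n)) /\ L1_cvg mu (fun n => int_op mu (K n) f) g.
Proof.
have /choice[K KP] := level_kernel.
exists K; split; first by move=> n; case: (KP n).
pose e n := 2 * (\int[mu]_x g x - \int[mu]_x level_fun n x).
apply: (@squeeze_cvge _ _ _ _ (cst 0%E) _ (fun n => (e n)%:E)).
- apply: nearW => n; apply/andP; split; last by case: (KP n).
  by apply: integral_ge0 => x _; rewrite lee_fin.
- exact: cvg_cst.
apply: cvg_EFin; first exact: nearW.
rewrite -[X in _ --> X](mulr0 2) -(subrr (\int[mu]_x g x)).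
apply: cvgM; first exact: cvg_cst.
apply: cvgB; first exact: cvg_cst.
apply: fine_cvg; rewrite -L1_EFin//; exact: level_fun_cvg_integral.
Qed.

End level_approximation.

(** The Fubini theorems speak of bundled sigma-finite measures; an equality of measure structures
    lets [mu] be replaced by substitution. *)
Lemma sigma_finite_measure_exists (d : measure_display) (T : measurableType d)
    (R : realType) (mu : {measure set T -> \bar R}) : sigma_finite setT mu ->
  exists nu : {sigma_finite_measure set T -> \bar R},
    mu = nu :> {measure set T -> \bar R}.
Proof.
case: mu => m [m1 m2] sf.
pose M : {measure set T -> \bar R} := Measure.Pack (Measure.Class m2).
pose s := Measure_isSigmaFinite.Build d T R M sf.
by exists (HB.pack_for {sigma_finite_measure set T -> \bar R} m M s).
Qed.

(** * Equivalence of the five conditions *)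

Local Open Scope ereal_scope.

Theorem theorem4p13 (d : measure_display) (T : measurableType d) (R : realType)
  (mu : {measure set T -> \bar R}) (f g : T -> R) :
  sigma_finite setT mu ->
  L1 mu f -> L1 mu g -> (forall x, (0 <= f x)%R) -> (forall x, (0 <= g x)%R) ->
  [<-> majorized mu g f;
       exists S : nat -> (T -> R) -> (T -> R),
         (forall k, semi_doubly_stochastic mu (S k)) /\ L1_cvg mu (fun k => S k f) g;
       exists K : nat -> T * T -> R,
         (forall n, sds_kernel mu (K n)) /\ L1_cvg mu (fun n => int_op mu (K n) f) g;
       (forall phi : R -> R, admissible_phi phi ->
          \int[mu]_x (phi (g x))%:E <= \int[mu]_x (phi (f x))%:E) /\
       \int[mu]_x (g x)%:E = \int[mu]_x (f x)%:E;
       (forall u : R, (0 < u)%R ->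
          \int[mu]_x (Num.max (g x - u) 0)%:E <= \int[mu]_x (Num.max (f x - u) 0)%:E) /\
       \int[mu]_x (g x)%:E = \int[mu]_x (f x)%:E].
Proof.
move=> sf f1 g1 f0 g0.
have [nu munu] := sigma_finite_measure_exists sf; subst mu.
pose dominated := (forall u : R, (0 < u)%R ->
    \int[nu]_x (Num.max (g x - u) 0)%:E <= \int[nu]_x (Num.max (f x - u) 0)%:E) /\
  \int[nu]_x (g x)%:E = \int[nu]_x (f x)%:E.
have kernels : dominated -> exists K : nat -> T * T -> R,
    (forall n, sds_kernel nu (K n)) /\ L1_cvg nu (fun n => int_op nu (K n) f) g.
  move=> [dom eqint]; apply: excess_kernels => //.
  - move=> u u0; have := dom u u0.
    by rewrite !L1_EFin ?lee_fin//; apply: L1_pospart => //; exact: ltW.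
  - by rewrite /Rintegral eqint.
have kernel_ops : (exists K : nat -> T * T -> R,
    (forall n, sds_kernel nu (K n)) /\ L1_cvg nu (fun n => int_op nu (K n) f) g) ->
  exists S : nat -> (T -> R) -> (T -> R),
    (forall k, semi_doubly_stochastic nu (S k)) /\ L1_cvg nu (fun k => S k f) g.
  move=> [K [sK Kg]]; exists (fun n => int_op nu (K n)); split => // n.
  exact: sds_kernel_op.
have ops_dominated : (exists S : nat -> (T -> R) -> (T -> R),
    (forall k, semi_doubly_stochastic nu (S k)) /\ L1_cvg nu (fun k => S k f) g) ->
  dominated.
  move=> [S [sS Sg]].
  have [dom eqint] := sds_limit_excess sf sS f1 g1 f0 Sg.
  split; last by rewrite !L1_EFin// eqint.
  move=> u u0; rewrite !L1_EFin ?lee_fin; first exact: dom.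
  - by apply: L1_pospart => //; exact: ltW.
  - by apply: L1_pospart => //; exact: ltW.
(* The cycle follows the order of the statement, so its arrows are composed from (5) => (3) => (2)
   => (5) and the passages between (1), (4) and (5). *)
tfae.
- by move=> maj; apply/kernel_ops/kernels; exact: majorized_excess.
- by move=> /ops_dominated/kernels.
- move=> /kernel_ops/ops_dominated[dom eqint]; split => //.
  exact: excess_le_convex.
- move=> [cvx eqint]; split => // u u0.
  by have := cvx _ (admissible_pospart (ltW u0)).
- exact: excess_majorized.
Qed.
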